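(* Let $a=(a_1,a_2,\dots)\in\mathscr X$, let $\mathcal P(a)$ be the first return map of the equation $\frac{dv}{dx}=\sum_{i=1}^\infty a_i(x)v^{i+1}$, $x\in I_T=[0,T]$, and let $H_a:I_T\rightarrow L(\mathcal H_{\rm FdB}^{cop}(\mathbb C);\mathbb C)$ be the solution, with $H_a(0)=1$, of $$\frac{dH}{dx}=\Bigl(\sum_{i=1}^\infty a_i(x)\,t_i'\,t^i\Bigr)H,\qquad x\in I_T.$$ Then $$\mathcal P(a)=\Theta\bigl(H_a(T)\bigr)=(\Theta\circ\rho_{\mathbb C}\circ E)(a).$$
   Context: Equations: $\mathscr X$ is the set of sequences $a=(a_1,a_2,\dots)$ of functions $a_i\in L^\infty(I_T)$ (complex-valued bounded measurable) with $\sup_{x\in I_T,\,i\in\mathbb N}\sqrt[i]{|a_i(x)|}<\infty$. For small $r$ let $v(x;r;a)$ be the Lipschitz solution on $I_T$ of $\frac{dv}{dx}=\sum_{i\ge1}a_i(x)v^{i+1}$ with $v(0;r;a)=r$. The first return map $\mathcal P(a):=v(T;\cdot;a)$ is a power series in $r$, convergent near $0$, of the form $r+\sum_{i\ge1}c_ir^{i+1}$. Iterated integrals and Chen map: $I_{i_1,\dots,i_k}(a)=\int\cdots\int_{0\le s_1\le\cdots\le s_k\le T}a_{i_k}(s_k)\cdots a_{i_1}(s_1)\,ds_k\cdots ds_1$. Let $\mathbb C\langle\mathbf X\rangle$ be the free associative unital algebra (unit $I$) in noncommutative variables $X_1,X_2,\dots$ with $\deg X_i=i$. The Chen map $E$ sends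 $a\in\mathscr X$ to the series $E(a)=I+\sum_{i=1}^\infty\bigl(\sum_{i_1+\cdots+i_k=i}I_{i_1,\dots,i_k}(a)X_{i_k}\cdots X_{i_1}\bigr)t^i$, an element of the algebra of series $\sum_{i\ge0}f_it^i$ with $f_i\in\mathbb C\langle\mathbf X\rangle$ homogeneous of degree $i$ (this algebra is the completion of $\mathbb C\langle\mathbf X\rangle$ with respect to its grading). Co-opposite Faà di Bruno Hopf algebra: $\mathcal H_{\rm FdB}^{cop}(\mathbb C)=\mathbb C[t_1,t_2,\dots]$ (commutative polynomials, $\deg t_i=i$, $t_0:=1$), with coproduct the algebra morphism given by $$\Delta_{\rm FdB}^{op}(t_i)=\sum_{j=0}^i t_j\otimes\Bigl(\sum\frac{(j+1)!}{l_0!\,l_1!\cdots l_i!}\,t_1^{l_1}\cdots t_i^{l_i}\Bigr),$$ the inner sum being over nonnegative integers $l_0,\dots,l_i$ with $l_0+\cdots+l_i=j+1$ and $l_1+2l_2+\cdots+il_i=i-j$, and counit the algebra morphism with $\varepsilon(t_i)=0$ for $i\ge1$. Its graded dual $\mathcal H_{\rm FdB}^{cop}(\mathbb C)^*$ is an algebra under convolution $\alpha*\beta=m_{\mathbb C}\circ(\alpha\otimes\beta)\circ\Delta_{\rm FdB}^{op}$ with unit $1=\varepsilon$. The elements $t_i'$ of the graded dual are defined by $t_i'(1)=0$, $t_i'(t_j)=\delta_{ij}$, $t_i'(t_{i_1}\cdots t_{i_k})=0$ for $k\ge2$. The space $L(\mathcal H_{\rm FdB}^{cop}(\mathbb C);\mathbb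 C)$ of linear functionals is identified with the algebra of series $f=\sum_{i\ge0}f_it^i$, $f_i$ in the dual of the degree-$i$ component (here $t$ is a formal variable, distinct from the generators $t_i$), with product extending convolution. The solution $H_a$ is obtained by Picard iteration; its coefficients in the series expansion are Lipschitz functions on $I_T$, the equation holds almost everywhere, and $H_a(T)$ is a character. The map $\rho_{\mathbb C}$ is the continuous extension, to a map from the algebra of series $\sum_{i\ge0}f_it^i$ with $f_i\in\mathbb C\langle\mathbf X\rangle$ homogeneous of degree $i$ into the algebra $L(\mathcal H_{\rm FdB}^{cop}(\mathbb C);\mathbb C)$ of series $\sum_{i\ge0}f_it^i$ with $f_i$ in the dual of the degree-$i$ component of $\mathcal H_{\rm FdB}^{cop}(\mathbb C)$, of the unital algebra morphism $\mathbb C\langle\mathbf X\rangle\rightarrow\mathcal H_{\rm FdB}^{cop}(\mathbb C)^*$ with $\rho_{\mathbb C}(X_i)=t_i'$ (applied to the coefficient of each $t^i$). For a character (unital algebra morphism to $\mathbb C$) $f=\sum_{i\ge0}f_it^i$ of $\mathcal H_{\rm FdB}^{cop}(\mathbb C)$, $\Theta(f)(r):=r+\sum_{i=1}^\infty f_i(t_i)\,r^{i+1}$. *)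

(* Defs.v *)
From HB Require Import structures.
From mathcomp Require Import all_boot all_order all_algebra finmap.
From mathcomp Require Import all_classical all_reals all_analysis.
From mathcomp Require Import complex.
(* The notations of monalg clash with those of mathcomp-analysis. *)
From mathcomp Require Import -(notations) monalg.

Set Implicit Arguments.
Unset Strict Implicit.
Unset Printing Implicit Defensive.

Import Order.TTheory GRing.Theory Num.Theory.
Import numFieldNormedType.Exports.

Local Open Scope classical_set_scope.
Local Open Scope ring_scope.

Notation "{ 'malg' G [ K ] }" := (@malg K G)
  (at level 0, K, G at level 2, format "{ 'malg'  G [ K ] }") : type_scope.
Notation "{ 'cmonom' I }" := (cmonom I)
  (at level 0, I at level 2, format "{ 'cmonom'  I }") : type_scope.
Notation "{ 'fmonom' I }" := (fmonom I)
  (at level 0, I at level 2, format "{ 'fmonom'  I }") : type_scope.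

(* The free algebra K<X_1, X_2, ...>: the letter [j : nat] stands for X_(j+1). *)
Notation freeX K := {malg K[{fmonom nat}]}.

(* K[t_1, t_2, ...]: the index [j : nat] stands for t_(j+1). *)
Notation FdB K := {malg K[{cmonom nat}]}.

(* FdB (x) FdB, as polynomials with coefficients in the left factor: p (x) m, for
   m a monomial, is the monomial m with coefficient p. *)
Notation FdB2 K := {malg (FdB K)[{cmonom nat}]}.

(* Rewriting with [mul_malgC] directly at type [FdB2 K] diverges. *)
Fact mul_malgCM (M : monomType) (S : nzRingType) (u v : S) (z : {malg S[M]}) :
  mkmalgU mone (u * v) * z = u *: (mkmalgU mone v * z).
Proof. by rewrite !mul_malgC scalerA. Qed.

Section FaaDiBruno.
Variable K : numFieldType.
Implicit Types (alpha beta f : {scalar FdB K}) (p q : FdB K).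

(* X_i, for i >= 1. *)
Definition X_ (i : nat) : freeX K := mkmalgU (fmu i.-1) 1.

(* t_i, with t_0 = 1. *)
Definition t_ (i : nat) : FdB K :=
  if i is j.+1 then mkmalgU (ucm j) 1 else 1.

Definition wdeg (m : {cmonom nat}) : nat :=
  (\sum_(j <- finsupp m) m j * j.+1)%N.

Definition tens p q : FdB2 K :=
  \sum_(m <- msupp q) mkmalgU m (mcoeff m q *: p).

(* The coproduct of t_i. *)
Definition Delta_t (i : nat) : FdB2 K :=
  \sum_(j < i.+1) tens (t_ j)
    (\sum_(l : {ffun 'I_i.+1 -> 'I_j.+2} |
           (\sum_k l k == j.+1)%N && (\sum_(k < i.+1) k * l k == i - j)%N)
       ((j.+1)`!%:R / (\prod_k (l k)`!)%:R) *:
         \prod_(k < i.+1 | (0 < k)%N) t_ k ^+ l k).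

(* The algebra morphism extending t_i |-> Delta_t i. *)
Definition Delta p : FdB2 K :=
  mmap (mkmalgU mone \o mkmalgU mone)
       (fun m : {cmonom nat} => \prod_(j <- finsupp m) Delta_t j.+1 ^+ m j) p.

(* The linear functional with prescribed values on the monomials. *)
Definition lin_ext (phi : {cmonom nat} -> K) p : K := mmap idfun phi p.

Lemma lin_ext_is_scalar phi : scalar (lin_ext phi).
Proof.
have Z c : forall p, lin_ext phi (c *: p) = c * lin_ext phi p.
  move=> p; rewrite /lin_ext (mmapEw (f := idfun) (msuppZ_le _ _)) mmapE mulr_sumr.
  by apply: eq_bigr => m _ /=; rewrite mcoeffZ mulrA.
by move=> c p q; rewrite -Z /lin_ext -mmapD.
Qed.

HB.instance Definition _ phi :=
  GRing.isLinear.Build K (FdB K) K *%R (lin_ext phi) (lin_ext_is_scalar phi).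

Definition functional (phi : {cmonom nat} -> K) : {scalar FdB K} := lin_ext phi.

(* m_K o (alpha (x) beta) o Delta. *)
Definition conv_fun alpha beta p : K :=
  mmap alpha (fun m => beta (mkmalgU m 1)) (Delta p).

Lemma conv_is_scalar alpha beta : scalar (conv_fun alpha beta).
Proof.
have DZ c p : Delta (c *: p) = (mkmalgU mone c : FdB K) *: Delta p.
  rewrite /Delta (mmapEw (f := mkmalgU mone \o mkmalgU mone) (msuppZ_le _ _)).
  rewrite mmapE scaler_sumr; apply: eq_bigr => m _ /=.
  by rewrite -mul_malgCM -mpolyCM mcoeffZ.
have PZ (h : {cmonom nat} -> K) c z :
    mmap alpha h ((mkmalgU mone c : FdB K) *: z) = c * mmap alpha h z.
  rewrite (mmapEw (f := alpha) (msuppZ_le _ _)) mmapE mulr_sumr.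
  by apply: eq_bigr => m _ /=; rewrite mcoeffZ mul_malgC linearZ mulrA.
move=> c p q; rewrite /conv_fun -PZ -DZ -mmapD; congr (mmap _ _ _).
exact: mmapD.
Qed.

HB.instance Definition _ alpha beta :=
  GRing.isLinear.Build K (FdB K) K *%R (conv_fun alpha beta)
    (conv_is_scalar alpha beta).

Definition conv alpha beta : {scalar FdB K} := conv_fun alpha beta.

Definition counit : {scalar FdB K} := functional (fun m => (m == mone)%:R).

(* t_i', for i >= 1. *)
Definition t_dual (i : nat) : {scalar FdB K} :=
  functional (fun m => (m == ucm i.-1)%:R).

(* \sum_n f_n t^n, as a functional: f_n on the component of degree n. *)
Definition series_dual (F : nat -> {scalar FdB K}) : {scalar FdB K} :=
  functional (fun m => F (wdeg m) (mkmalgU m 1)).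

Definition is_character f : Prop :=
  f 1 = 1 /\ forall p q, f (p * q) = f p * f q.

(* The word X_(i_1) ... X_(i_k) goes to t_(i_1)' * ... * t_(i_k)'. *)
Definition rho_word (w : {fmonom nat}) : {scalar FdB K} :=
  foldr (fun j alpha => conv (t_dual j.+1) alpha) counit w.

Definition rho_free (u : freeX K) : {scalar FdB K} :=
  functional (fun m => mmap idfun (fun w => rho_word w (mkmalgU m 1)) u).

(* The series \sum_n u_n t^n is given by its coefficients u_n. *)
Definition rho (u : nat -> freeX K) : {scalar FdB K} :=
  series_dual (fun n => rho_free (u n)).

(* The coefficient of r^n in Theta(f)(r). *)
Definition Theta f (n : nat) : K :=
  match n with
  | 0%N => 0
  | 1%N => 1
  | i.+1 => f (t_ i)
  end.

End FaaDiBruno.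

Section ComplexValued.
Variable R : realType.
Local Notation C := (R[i]).
Local Notation mu := (@lebesgue_measure R).

Definition cmeasurable (D : set R) (f : R -> C) : Prop :=
  measurable_fun D (fun x => complex.Re (f x)) /\
  measurable_fun D (fun x => complex.Im (f x)).

Definition cint (D : set R) (f : R -> C) : C :=
  Complex (\int[mu]_(x in D) complex.Re (f x))
          (\int[mu]_(x in D) complex.Im (f x)).

Definition ccvg (u : nat -> C) (l : C) : Prop :=
  (fun n => complex.Re (u n)) @ \oo --> complex.Re l /\
  (fun n => complex.Im (u n)) @ \oo --> complex.Im l.

Definition cderiv (v : R -> C) (x : R) (l : C) : Prop :=
  is_derive x (1 : R) (fun y => complex.Re (v y)) (complex.Re l) /\
  is_derive x (1 : R) (fun y => complex.Im (v y)) (complex.Im l).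

Definition clipschitz (D : set R) (v : R -> C) : Prop :=
  exists L : R, forall x y, D x -> D y ->
    Normc.normc (v x - v y) <= L * `|x - y|.

End ComplexValued.

Section CenterProblem.
Variable R : realType.
Local Notation C := (R[i]).
Local Notation mu := (@lebesgue_measure R).
Local Notation I_ T := (`[0, T]%classic : set R).
Implicit Types (T : R) (a : nat -> R -> C).

(* A sequence is indexed by [nat]; its term of index 0 is never used. The a_i
   are Borel representatives of classes modulo null sets, whence the a.e. bound. *)
Definition in_X T a : Prop :=
  (forall i, (0 < i)%N -> cmeasurable (I_ T) (a i)) /\
  exists M : R, {ae mu, forall x, I_ T x -> forall i, (0 < i)%N ->
    Normc.normc (a i x) `^ (i%:R^-1) <= M}.

Definition abel_solution T a (r : C) (v : R -> C) : Prop :=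
  [/\ v 0 = r,
      clipschitz (I_ T) v &
      {ae mu, forall x, I_ T x -> exists2 l : C,
        ccvg (fun n => \sum_(1 <= i < n) a i x * v x ^+ i.+1) l &
        cderiv v x l}].

(* v(T; r; a); arbitrary for the r at which there is no solution. *)
Definition first_return_map T a (r : C) : C :=
  xget 0 [set w | exists2 v, abel_solution T a r v & w = v T].

(* The germ of P at 0 is the sum of the convergent power series (c_n). *)
Definition has_expansion (P : C -> C) (c : nat -> C) : Prop :=
  exists2 d : R, 0 < d & forall r : C, Normc.normc r < d ->
    ccvg (fun n => \sum_(k < n) c k * r ^+ k) (P r).

(* For w = [:: i_k; ...; i_1]: the outermost variable comes first. *)
Fixpoint iint a (w : seq nat) (x : R) : C :=
  if w is i :: w' then cint (I_ x) (fun s => a i s * iint a w' s) else 1.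

(* I_(i_1, ..., i_k)(a) for s = [:: i_1; ...; i_k]. *)
Definition iterated_integral T a (s : seq nat) : C := iint a (rev s) T.

(* The coefficient of t^n in E(a). *)
Definition chen T a (n : nat) : freeX C :=
  if n is 0%N then 1 else
  \sum_(k < n.+1)
    \sum_(s : k.-tuple 'I_n.+1 |
          all (fun i : 'I_n.+1 => (0 < i)%N) s && (\sum_(i <- s) i == n)%N)
      iterated_integral T a [seq val i | i <- s] *:
        \prod_(i <- rev s) X_ C i.

(* \sum_(i >= 1) a_i(x) t_i' t^i. *)
Definition FdB_field a (x : R) : {scalar FdB C} :=
  series_dual (fun n =>
    if n is 0%N then functional (fun=> 0)
    else functional (fun m => a n x * t_dual C n (mkmalgU m 1))).

Definition FdB_solution T a (H : R -> {scalar FdB C}) : Prop :=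
  [/\ H 0 =1 counit C,
      forall p, clipschitz (I_ T) (fun x => H x p) &
      {ae mu, forall x, I_ T x ->
        forall p, cderiv (fun y => H y p) x (conv (FdB_field a x) (H x) p)}].

(* H_a; its values outside of I_T are irrelevant. *)
Definition FdB_flow T a : R -> {scalar FdB C} :=
  xget ((fun=> counit C) : {classic (R -> {scalar FdB C})})
       [set H | FdB_solution T a H].

End CenterProblem.

(* Main.v *)
From HB Require Import structures.
From mathcomp Require Import all_boot all_order all_algebra finmap.
From mathcomp Require Import all_classical all_reals all_analysis.
From mathcomp Require Import measurable_realfun complex.
From mathcomp Require Import -(notations) monalg.
From mathcomp Require Import ring lra.
(* Imported last, so that [conv] is the convolution rather than the operator of convex. *)
Require Import Defs.

(* The t_i' are primitive, so both the functional series G(x) obtained from the iterated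
   integrals on [0, x] (whose value at T is rho (E a)) and H_a solve the same equation, which
   is triangular for the grading; an induction on the degree, resting on the fact that a
   Lipschitz function with almost everywhere zero derivative is constant, gives G = H_a and
   then the multiplicativity of H_a.  For a character H with c_k = H(t_k), the functional
   t_j' * H takes on t_i the coefficient of r^(i+1) in (sum_k c_k r^(k+1))^(j+1), by the
   multinomial theorem; hence v = sum_k c_k r^(k+1) formally solves the Abel equation.  It
   converges for small r since the c_k are dominated by the coefficients of the Picard
   iterates W_0 = X, W_(n+1) = X + T sum_j M^j W_n^(j+1), which are bounded by 2 rho at the
   fixed radius rho = 1 / (16 M (1 + T)).  Finally the Abel equation has at most one
   Lipschitz solution close to a small one, by continuation along the interval. *)

Set Implicit Arguments.
Unset Strict Implicit.
Unset Printing Implicit Defensive.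

Import Order.TTheory GRing.Theory Num.Theory.
Import numFieldNormedType.Exports.

Local Open Scope classical_set_scope.
Local Open Scope ring_scope.

(** * The coproduct and the convolution *)

(** [first_return_map] selects the endpoint of an arbitrary Lipschitz solution, about whose size
    nothing is known beforehand. The expansion therefore rests on a uniqueness statement comparing
    one small solution with any other, which is why a contraction on a fixed ball is not enough and
    a continuation is used. Multiplicativity is not read off shuffle relations between iterated
    integrals: convolving with a functional that is a derivation relative to the counit obeys a
    Leibniz rule, so [H (p q)] and [H p * H q] have the same derivative as soon as [H] is
    multiplicative in lower degrees. Power series are never composed. All identities are between
    coefficients of truncated polynomials, because a coefficient of degree d in a power of exponent
    at least 2 of a series without constant term involves only its coefficients of degree below d.
    This one remark yields the triangular shape of the system, the agreement of truncations and the
    induction that bounds the [c_k]. *)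

Section FaaDiBrunoTheory.
Variable K : numFieldType.
Implicit Types (alpha beta : {scalar FdB K}) (m p q : {cmonom nat}).

Local Notation U m := (mkmalgU m 1 : FdB K).

Lemma wdegEw m (E : {fset nat}) : (finsupp m `<=` E)%fset ->
  wdeg m = (\sum_(j <- E) m j * j.+1)%N.
Proof.
move=> le; rewrite /wdeg; apply: big_fset_incl => // j _.
by rewrite -cmE_eq0 => /eqP ->.
Qed.

Lemma wdegM p q : wdeg (mmul p q) = (wdeg p + wdeg q)%N.
Proof.
rewrite (wdegEw (E := (finsupp p `|` finsupp q)%fset)) ?mdomD ?fsubset_refl //.
rewrite (wdegEw (fsubsetUl (finsupp p) (finsupp q))).
rewrite (wdegEw (fsubsetUr (finsupp p) (finsupp q))) -big_split /=.
by apply: eq_bigr => j _; rewrite cmM mulnDl.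
Qed.

Lemma wdeg1 : wdeg mone = 0%N.
Proof. by rewrite /wdeg mdom1 big_seq_fset0. Qed.

Lemma wdegU j : wdeg (ucm j) = j.+1.
Proof. by rewrite /wdeg mdomU big_seq_fset1 cmUU mul1n. Qed.

Lemma wdeg_eq0 m : wdeg m = 0%N -> m = mone.
Proof.
move=> h; apply/eqP/cmP => j; rewrite cm1.
have : (m j * j.+1 <= wdeg m)%N.
  rewrite (wdegEw (fsubsetUl (finsupp m) [fset j]%fset)).
  rewrite (big_fsetD1 j) /=; first exact: leq_addr.
  by rewrite in_fsetU in_fset1 eqxx orbT.
by rewrite h leqn0 muln_eq0 orbF => /eqP.
Qed.

Lemma monom_mulE p q : U p * U q = U (mmul p q).
Proof. by rewrite malgM_def fgmulUU mulr1. Qed.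

Definition mono (c : K) p q : FdB2 K := mkmalgU q (mkmalgU p c).

Lemma monoM c p q c' p' q' :
  mono c p q * mono c' p' q' = mono (c * c') (mmul p p') (mmul q q').
Proof. by rewrite /mono malgM_def fgmulUU malgM_def fgmulUU. Qed.

Lemma mmap_mono alpha (h : {cmonom nat} -> K) c p q :
  mmap alpha h (mono c p q) = c * (alpha (U p) * h q).
Proof.
rewrite /mono mmapU mulrA; congr (_ * _).
have -> : mkmalgU p c = c *: U p :> FdB K.
  by rewrite -mul_malgC malgM_def fgmulUU mulr1 mul1m.
exact: scalarZ.
Qed.

(** Total degree n, witnessed by a list of pure tensors in which repetitions and cancellations are
    allowed. Stability under sums and products is then immediate, without any computation of
    supports. *)
Definition homog (n : nat) (z : FdB2 K) : Prop :=
  exists2 s : seq (K * {cmonom nat} * {cmonom nat}),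
    z = \sum_(u <- s) mono u.1.1 u.1.2 u.2 &
    forall u, u \in s -> (wdeg u.1.2 + wdeg u.2)%N = n.

Lemma homog_mono n c p q : (wdeg p + wdeg q)%N = n -> homog n (mono c p q).
Proof.
move=> h; exists [:: (c, p, q)]; first by rewrite big_seq1.
by move=> u; rewrite inE => /eqP ->.
Qed.

Lemma homog0 n : homog n 0.
Proof. by exists [::]; rewrite ?big_nil. Qed.

Lemma homogD n y z : homog n y -> homog n z -> homog n (y + z).
Proof.
move=> [s -> hs] [t -> ht]; exists (s ++ t); first by rewrite big_cat.
by move=> u; rewrite mem_cat => /orP[/hs|/ht].
Qed.

Lemma homog_sum n (I : Type) (r : seq I) (P : pred I) (F : I -> FdB2 K) :
  (forall i, P i -> homog n (F i)) -> homog n (\sum_(i <- r | P i) F i).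
Proof. by move=> h; apply: big_ind => //; [exact: homog0|exact: homogD]. Qed.

Lemma homogM n n' y z : homog n y -> homog n' z -> homog (n + n') (y * z).
Proof.
move=> [s -> hs] [t -> ht]; rewrite mulr_suml big_seq; apply: homog_sum => u us.
rewrite mulr_sumr big_seq; apply: homog_sum => v vt.
rewrite monoM; apply: homog_mono.
by rewrite !wdegM addnACA (hs _ us) (ht _ vt).
Qed.

Lemma homog1 : homog 0 1.
Proof. by apply: (@homog_mono 0 1 mone mone); rewrite wdeg1. Qed.

Lemma homogX n y k : homog n y -> homog (k * n) (y ^+ k).
Proof.
move=> h; elim: k => [|k IH]; first exact: homog1.
by rewrite exprS mulSn; exact: homogM.
Qed.

Lemma homog_prod (I : Type) (r : seq I) (d : I -> nat) (F : I -> FdB2 K) :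
  (forall i, homog (d i) (F i)) -> homog (\sum_(i <- r) d i) (\prod_(i <- r) F i).
Proof.
move=> h; elim: r => [|i r IH]; first by rewrite !big_nil; exact: homog1.
by rewrite !big_cons; exact: homogM.
Qed.

(** Reduces an identity between functionals on a homogeneous tensor to pairs of monomials of the
    right total degree. An empty [r] gives vanishing, a singleton gives equality, and a list of
    words gives the expansion of a convolution. *)
Lemma mmap_homog n z (I : Type) (r : seq I) (c : I -> K)
    alpha (h : {cmonom nat} -> K)
    (alphas : I -> {scalar FdB K}) (hs : I -> {cmonom nat} -> K) :
  homog n z ->
  (forall p q, (wdeg p + wdeg q)%N = n ->
    alpha (U p) * h q = \sum_(i <- r) c i * (alphas i (U p) * hs i q)) ->
  mmap alpha h z = \sum_(i <- r) c i * mmap (alphas i) (hs i) z.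
Proof.
move=> [s -> hz] H; rewrite raddf_sum /=.
under [RHS]eq_bigr do rewrite raddf_sum /= mulr_sumr.
rewrite exchange_big /= big_seq [RHS]big_seq; apply: eq_bigr => u us.
rewrite mmap_mono H ?hz // mulr_sumr; apply: eq_bigr => i _.
by rewrite mmap_mono mulrCA.
Qed.

Lemma functionalU (phi : {cmonom nat} -> K) m : functional phi (U m) = phi m.
Proof. by rewrite /functional /= /lin_ext mmapU /= mul1r. Qed.

Lemma scalarE alpha (x : FdB K) :
  alpha x = \sum_(m <- msupp x) mcoeff m x * alpha (U m).
Proof.
rewrite {1}[x]monalgE raddf_sum /=; apply: eq_bigr => m _.
have -> : mkmalgU m (mcoeff m x) = mcoeff m x *: U m :> FdB K.
  by rewrite -mul_malgC malgM_def fgmulUU mulr1 mul1m.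
exact: scalarZ.
Qed.

Lemma scalar_ext alpha beta : (forall m, alpha (U m) = beta (U m)) -> alpha =1 beta.
Proof. by move=> h x; rewrite !scalarE; apply: eq_bigr => m _; rewrite h. Qed.

Definition Delta_mono m : FdB2 K :=
  \prod_(j <- finsupp m) Delta_t K j.+1 ^+ m j.

Lemma Delta_monoEw m (E : {fset nat}) : (finsupp m `<=` E)%fset ->
  Delta_mono m = \prod_(j <- E) Delta_t K j.+1 ^+ m j.
Proof.
move=> le; rewrite /Delta_mono; apply: big_fset_incl => // j _.
by rewrite -cmE_eq0 => /eqP ->.
Qed.

Lemma Delta_monoM p q : Delta_mono (mmul p q) = Delta_mono p * Delta_mono q.
Proof.
rewrite (Delta_monoEw (E := (finsupp p `|` finsupp q)%fset)) ?mdomD ?fsubset_refl //.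
rewrite (Delta_monoEw (fsubsetUl (finsupp p) (finsupp q))).
rewrite (Delta_monoEw (fsubsetUr (finsupp p) (finsupp q))) -big_split /=.
by apply: eq_bigr => j _; rewrite cmM exprD.
Qed.

Lemma Delta_monoU j : Delta_mono (ucm j) = Delta_t K j.+1.
Proof. by rewrite /Delta_mono mdomU big_seq_fset1 cmUU expr1. Qed.

Lemma DeltaU m : Delta (U m) = Delta_mono m.
Proof. rewrite /Delta; rewrite mmapU /=; exact: mul1r. Qed.

Lemma convU alpha beta m :
  conv alpha beta (U m) = mmap alpha (fun q => beta (U q)) (Delta_mono m).
Proof. by rewrite /conv /= /conv_fun DeltaU. Qed.

(** The right-hand factor of [t_j] in the coproduct of [t_i]: with [t_0 = 1], this is the
    coefficient of r^(i+1) in the power j+1 of the generic series with coefficients [t_k] at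
    r^(k+1). *)
Definition inner_sum (i j : nat) : FdB K :=
  \sum_(l : {ffun 'I_i.+1 -> 'I_j.+2} |
           (\sum_k l k == j.+1)%N && (\sum_(k < i.+1) k * l k == i - j)%N)
       ((j.+1)`!%:R / (\prod_k (l k)`!)%:R) *:
         \prod_(k < i.+1 | (0 < k)%N) t_ K k ^+ l k.

Lemma Delta_tE i :
  Delta_t K i = \sum_(j < i.+1) tens (t_ K j) (inner_sum i j).
Proof. by []. Qed.

Lemma tensE (E : {fset {cmonom nat}}) (x y : FdB K) : (msupp y `<=` E)%fset ->
  tens x y = \sum_(m <- E) mkmalgU m (mcoeff m y *: x).
Proof.
move=> le; rewrite /tens; apply: big_fset_incl => // j _ /mcoeff_outdom ->.
by rewrite scale0r monalgU0.
Qed.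

Lemma tens_sumr (x : FdB K) (I : Type) (r : seq I) (P : pred I) (F : I -> FdB K) :
  tens x (\sum_(i <- r | P i) F i) = \sum_(i <- r | P i) tens x (F i).
Proof.
have D y z : tens x (y + z) = tens x y + tens x z.
  pose E := (msupp (y + z) `|` (msupp y `|` msupp z))%fset.
  rewrite (tensE (E := E)) ?fsubsetUl // [tens x y](tensE (E := E)); last first.
    by rewrite (fsubset_trans (fsubsetUl _ (msupp z))) ?fsubsetUr.
  rewrite [tens x z](tensE (E := E)); last first.
    by rewrite (fsubset_trans (fsubsetUr (msupp y) _)) ?fsubsetUr.
  rewrite -big_split /=; apply: eq_bigr => m _.
  by rewrite mcoeffD scalerDl monalgUD.
apply: (big_morph (tens x)); first exact: D.
by rewrite /tens msupp0 big_seq_fset0.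
Qed.

Lemma tensZU c p q : tens (U p) (c *: U q) = mono c p q.
Proof.
rewrite (tensE (E := [fset q]%fset)); last first.
  by rewrite (fsubset_trans (msuppZ_le _ _)) // msuppU_le.
rewrite big_seq_fset1 mcoeffZ mcoeffUU mulr1 /mono; congr mkmalgU.
by rewrite -mul_malgC malgM_def fgmulUU mulr1 mul1m.
Qed.

Lemma t_U i : t_ K i = U (if i is j.+1 then ucm j else mone).
Proof. by case: i. Qed.

Lemma wdeg_t i : wdeg (if i is j.+1 then ucm j else mone) = i.
Proof. by case: i => [|i]; rewrite ?wdeg1 ?wdegU. Qed.

Lemma prod_t_U n (l : 'I_n -> nat) :
  exists2 q, \prod_(k < n | (0 < k)%N) t_ K k ^+ l k = U q &
    wdeg q = (\sum_(k < n) k * l k)%N.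
Proof.
have X k e : exists2 q, t_ K k ^+ e = U q & wdeg q = (k * e)%N.
  elim: e => [|e [q hq dq]]; first by exists mone; rewrite ?wdeg1 ?muln0.
  exists (mmul (if k is j.+1 then ucm j else mone) q).
    rewrite exprS hq (t_U k); exact: monom_mulE.
  by rewrite wdegM dq wdeg_t mulnS.
rewrite big_mkcond /=.
apply: (big_ind2 (fun x d => exists2 q, x = U q & wdeg q = d)).
- by exists mone; rewrite ?wdeg1.
- move=> x d y e [q -> dq] [q' -> dq']; exists (mmul q q').
    exact: monom_mulE.
  by rewrite wdegM dq dq'.
- case=> [[|k] hk] _ /=; first by exists mone; rewrite ?wdeg1.
  by have [q -> dq] := X k.+1 (l (Ordinal hk)); exists q.
Qed.

(** The weight condition i - j on the exponents completes the degree j of the left factor. *)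
Lemma Delta_t_homog i : homog i (Delta_t K i).
Proof.
rewrite Delta_tE; apply: homog_sum => j _; rewrite tens_sumr.
apply: homog_sum => l /andP[_ /eqP hl].
have [q -> dq] := @prod_t_U i.+1 (fun k => l k).
rewrite t_U; rewrite tensZU; apply: homog_mono.
by rewrite wdeg_t dq hl subnKC // -ltnS.
Qed.

Lemma Delta_mono_homog m : homog (wdeg m) (Delta_mono m).
Proof.
by apply: homog_prod => j; apply: homogX; exact: Delta_t_homog.
Qed.

Lemma mmap_tens alpha beta x y :
  mmap alpha (fun q => beta (U q)) (tens x y) = alpha x * beta y.
Proof.
rewrite raddf_sum /= [beta y]scalarE mulr_sumr; apply: eq_bigr => m _.
rewrite mmapU mulrCA mulrA; congr (_ * _); exact: scalarZ.
Qed.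

Lemma conv_t alpha beta i : (0 < i)%N ->
  conv alpha beta (t_ K i) = \sum_(j < i.+1) alpha (t_ K j) * beta (inner_sum i j).
Proof.
case: i => // i _; rewrite /t_ convU Delta_monoU Delta_tE raddf_sum /=.
by apply: eq_bigr => j _; exact: mmap_tens.
Qed.

End FaaDiBrunoTheory.

(** * The counit and derivations relative to it *)

Section Coproduct.
Variable K : numFieldType.
Implicit Types (alpha beta H : {scalar FdB K}) (m p q : {cmonom nat}).

Local Notation U m := (mkmalgU m 1 : FdB K).

(** A named version of [U], to carry the structure of multiplicative map from which [counitl]
    inherits multiplicativity. *)
Definition monomU m : FdB K := U m.

Lemma monomU_mmorphism : monalg.mmorphism monomU.
Proof. by split => // p q; rewrite /monomU monom_mulE. Qed.

HB.instance Definition _ :=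
  monalg.isMultiplicative.Build {cmonom nat} (FdB K) monomU monomU_mmorphism.

(* The morphism (counit (x) id). *)
Definition counitl : FdB2 K -> FdB K :=
  mmap (@mkmalgU {cmonom nat} K mone \o mcoeff mone) monomU.

Lemma counitl_is_multiplicative : multiplicative counitl.
Proof. exact: mmap_is_multiplicative. Qed.

Lemma counitlM : {morph counitl : y z / y * z}.
Proof. by case: counitl_is_multiplicative. Qed.

Lemma counitl1 : counitl 1 = 1.
Proof. by case: counitl_is_multiplicative. Qed.

Lemma counitl_sum (I : Type) (r : seq I) (F : I -> FdB2 K) :
  counitl (\sum_(i <- r) F i) = \sum_(i <- r) counitl (F i).
Proof. exact: raddf_sum. Qed.

Lemma counitlU m : counit K (U m) = (m == mone)%:R.
Proof. exact: functionalU. Qed.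

Lemma counitl_mono c p q : counitl (mono c p q) = (c * counit K (U p)) *: U q.
Proof.
rewrite /counitl /mono mmapU /= mcoeffU counitlU mulr_natr.
exact: mul_malgC.
Qed.

Lemma mmap_counit H n z : homog n z ->
  mmap (counit K) (fun q => H (U q)) z = H (counitl z).
Proof.
move=> [s -> _]; rewrite counitl_sum !raddf_sum /=; apply: eq_bigr => u _.
rewrite mmap_mono counitl_mono mulrA; exact/esym/scalarZ.
Qed.

(** Values of sum 1 mean a single nonzero one, equal to 1, and the weighted sum then tells its
    position. Hence [inner_sum i 0] has one term only. *)
Lemma ffun_sum1 i (l : {ffun 'I_i.+1 -> 'I_2}) :
  (\sum_k l k = 1)%N -> (\sum_(k < i.+1) k * l k = i)%N ->
  forall k, l k = (k == ord_max) :> nat.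
Proof.
move=> l1 l2.
have [k0 k0P] : exists k, l k != 0 :> nat.
  apply/existsP; apply: contraT; rewrite negb_exists => /forallP h.
  by move: l1; rewrite big1 // => k _; apply/eqP; rewrite -[_ == _]negbK.
move: l1; rewrite (bigD1 k0) //= => l1.
have /eqP lk0 : l k0 == 1 :> nat by rewrite eqn_leq lt0n k0P andbT; exact: (ltn_ord (l k0)).
move: l1; rewrite lk0 => -[/eqP]; rewrite sum_nat_eq0 => /forall_inP l0.
have -> : ord_max = k0.
  apply: val_inj; rewrite -[LHS]l2 (bigD1 k0) //= lk0 muln1 big1 ?addn0 // => k /l0.
  by move=> /eqP ->; rewrite muln0.
move=> k; have [->//|/l0/eqP //] := eqVneq k k0.
Qed.

Lemma inner_sum0 i : inner_sum K i 0 = t_ K i.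
Proof.
pose l0 : {ffun 'I_i.+1 -> 'I_2} := [ffun k => inord (k == ord_max)].
have l0E k : l0 k = (k == ord_max) :> nat by rewrite ffunE inordK //; case: eqP.
rewrite /inner_sum (bigD1 l0) /=; last first.
  apply/andP; split.
    by rewrite (bigD1 ord_max) //= l0E eqxx big1 // => k /negbTE; rewrite l0E => ->.
  rewrite (bigD1 ord_max) //= l0E eqxx muln1 subn0 big1 ?addn0 //.
  by move=> k /negbTE; rewrite l0E => ->; rewrite muln0.
rewrite [X in _ + X]big1 ?addr0 => [|l /andP[/andP[/eqP l1 /eqP l2]]]; last first.
  case/eqP; apply/ffunP => k; apply: val_inj => /=; rewrite l0E.
  by apply: ffun_sum1; rewrite ?l2 ?subn0.
have -> : ((1`!)%:R / (\prod_k (l0 k)`!)%:R : K) = 1.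
  by rewrite big1 ?divr1 // => k _; rewrite l0E; case: eqP.
(* For i = 0 the factor at [ord_max] is excluded from the product, in agreement with [t_0 = 1]. *)
rewrite scale1r big_mkcond (bigD1 ord_max) //= big1 ?mulr1 => [|k /negbTE kn].
  by rewrite l0E eqxx expr1; case: i {l0 l0E}.
by rewrite l0E kn expr0 if_same.
Qed.

Lemma counitl_tens p (y : FdB K) : counitl (tens (U p) y) = (p == mone)%:R *: y.
Proof.
rewrite [in RHS](monalgE y) scaler_sumr {1}/tens counitl_sum.
apply: eq_bigr => q _; have -> : mkmalgU q (mcoeff q y *: U p) = mono (mcoeff q y) p q.
  rewrite /mono; congr mkmalgU.
  by rewrite -mul_malgC malgM_def fgmulUU mulr1 mul1m.
rewrite counitl_mono counitlU mulrC -scalerA; congr (_ *: _).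
by rewrite -mul_malgC malgM_def fgmulUU mulr1 mul1m.
Qed.

(** The counit kills every [t_j] with j > 0, so only the term j = 0 remains. *)
Lemma counitl_Delta_t i : (0 < i)%N -> counitl (Delta_t K i) = t_ K i.
Proof.
move=> i0; rewrite Delta_tE counitl_sum big_ord_recl /= big1 => [|j _].
  by rewrite counitl_tens eqxx scale1r inner_sum0 addr0.
rewrite /t_ counitl_tens; case: eqP => [/(congr1 wdeg)|_]; last by rewrite scale0r.
by rewrite wdegU wdeg1.
Qed.

(** The left counit axiom. Both sides are multiplicative, so the generators suffice; the monomial is
    then recovered from its exponents. *)
Lemma counitl_Delta_mono m : counitl (Delta_mono K m) = U m.
Proof.
have X1 y k : counitl (y ^+ k) = counitl y ^+ k.
  by elim: k => [|k IH]; rewrite ?expr0 ?counitl1 // !exprS counitlM IH.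
rewrite /Delta_mono (big_morph _ counitlM counitl1).
under eq_bigr do rewrite X1 counitl_Delta_t //.
have XU j e : exists2 q, t_ K j.+1 ^+ e = U q & forall i, q i = ((j == i) * e)%N.
  elim: e => [|e [q hq dq]]; first by exists mone => // i; rewrite cm1 muln0.
  exists (mmul (ucm j) q); first by rewrite exprS hq; exact: monom_mulE.
  by move=> i; rewrite cmM cmU dq mulnS.
have [q -> qE] : exists2 q, \prod_(j <- finsupp m) t_ K j.+1 ^+ m j = U q &
    forall i, q i = (\sum_(j <- finsupp m) (j == i) * m j)%N.
  elim: (enum_fset (finsupp m)) => [|j s [q hq dq]].
    by exists mone; rewrite ?big_nil // => i; rewrite big_nil cm1.
  have [q' hq' dq'] := XU j (m j).
  exists (mmul q' q); first by rewrite big_cons hq hq'; exact: monom_mulE.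
  by move=> i; rewrite big_cons cmM dq dq'.
suff -> : q = m by [].
apply/eqP/cmP => i; rewrite qE.
have [im|im] := boolP (i \in finsupp m).
  rewrite (big_fsetD1 i) //= eqxx mul1n big_seq big1 ?addn0 // => j.
  by rewrite in_fsetD1 => /andP[/negbTE ->].
rewrite big_seq big1 ?(fsfun_dflt im) // => j jm.
by case: eqP => // ji; rewrite -ji jm in im.
Qed.

Lemma mmap_counit_Delta H m :
  mmap (counit K) (fun q => H (U q)) (Delta_mono K m) = H (U m).
Proof. by rewrite (mmap_counit _ (Delta_mono_homog K m)) counitl_Delta_mono. Qed.

(** On pure tensors this is the product rule for [alpha] on the left times multiplicativity of [h]
    on the right. The latter is only assumed below the total degree: when both left factors have
    degree 0 they equal 1, where a derivation vanishes, and otherwise the right factors have smaller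
    degree. That gap is what makes an induction on the degree possible. *)
Lemma mmap_derivation n n' y z alpha (h : {cmonom nat} -> K) :
  homog n y -> homog n' z ->
  (forall p q, alpha (U (mmul p q)) =
     alpha (U p) * counit K (U q) + counit K (U p) * alpha (U q)) ->
  (forall p q, (wdeg p + wdeg q < n + n')%N -> h (mmul p q) = h p * h q) ->
  mmap alpha h (y * z) = mmap alpha h y * mmap (counit K) h z
                       + mmap (counit K) h y * mmap alpha h z.
Proof.
move=> [s -> hs] [t -> ht] der hM.
have E beta r : mmap beta h (\sum_(u <- r) mono u.1.1 u.1.2 u.2) =
    \sum_(u <- r) u.1.1 * (beta (U u.1.2) * h u.2).
  by rewrite raddf_sum; apply: eq_bigr => u _; exact: mmap_mono.
have EM (u v : K * {cmonom nat} * {cmonom nat}) :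
    mmap alpha h (mono u.1.1 u.1.2 u.2 * mono v.1.1 v.1.2 v.2) =
    u.1.1 * v.1.1 * (alpha (U (mmul u.1.2 v.1.2)) * h (mmul u.2 v.2)).
  by rewrite monoM; exact: mmap_mono.
have ES : mmap alpha h ((\sum_(u <- s) mono u.1.1 u.1.2 u.2) *
      (\sum_(v <- t) mono v.1.1 v.1.2 v.2)) = \sum_(u <- s) \sum_(v <- t)
    u.1.1 * v.1.1 * (alpha (U (mmul u.1.2 v.1.2)) * h (mmul u.2 v.2)).
  rewrite mulr_suml raddf_sum; apply: eq_bigr => u _.
  rewrite mulr_sumr raddf_sum; apply: eq_bigr => v _; exact: EM.
rewrite ES !E.
have e1 : counit K (U mone) = 1 by rewrite counitlU eqxx.
(* Abstracting the values of the functionals keeps rewriting from unfolding them. *)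
suff gen (A B : {cmonom nat} -> K) :
  (forall p q, A (mmul p q) = A p * B q + B p * A q) -> B mone = 1 ->
  \sum_(u <- s) \sum_(v <- t) u.1.1 * v.1.1 * (A (mmul u.1.2 v.1.2) * h (mmul u.2 v.2)) =
  (\sum_(u <- s) u.1.1 * (A u.1.2 * h u.2)) * (\sum_(u <- t) u.1.1 * (B u.1.2 * h u.2)) +
  (\sum_(u <- s) u.1.1 * (B u.1.2 * h u.2)) * (\sum_(u <- t) u.1.1 * (A u.1.2 * h u.2)).
  exact: (gen (fun p => alpha (U p)) (fun p => counit K (U p)) der e1).
move=> {}der {}e1; clear E EM ES.
have a1 : A mone = 0.
  have := der mone mone; rewrite mul1m e1 mulr1 mul1r.
  by move/eqP; rewrite -subr_eq0 opprD addrA subrr sub0r oppr_eq0 => /eqP.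
rewrite [X in _ = X + _]mulr_suml [X in _ = _ + X]mulr_suml.
rewrite -big_split /= big_seq [RHS]big_seq; apply: eq_bigr => u us.
rewrite [X in _ = X + _]mulr_sumr [X in _ = _ + X]mulr_sumr.
rewrite -big_split /= big_seq [RHS]big_seq; apply: eq_bigr => v vt.
rewrite der.
have [/eqP|] := eqVneq (wdeg u.1.2 + wdeg v.1.2)%N 0%N.
  rewrite addn_eq0 => /andP[/eqP/wdeg_eq0 -> /eqP/wdeg_eq0 ->].
  by rewrite a1 !(mulr0, mul0r, addr0).
rewrite -lt0n => gt0; rewrite hM; first by ring.
rewrite -(hs _ us) -(ht _ vt) addnACA -[ltnLHS]add0n ltn_add2r //.
Qed.

End Coproduct.

(** * The multinomial theorem *)

Section Multinomial.
Variables (K : numFieldType).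

(* The exponential generating series of the powers, truncated at order m, is multiplicative. *)
Lemma coef_prod_exp (A : comAlgType K) (m : nat) (s : seq A) (d : nat) :
  (d <= m)%N ->
  (\prod_(x <- s) \sum_(l < m.+1) (((l`!)%:R^-1 : K) *: x ^+ l)%:P * 'X^l)`_d
    = ((d`!)%:R^-1 : K) *: (\sum_(x <- s) x) ^+ d.
Proof.
elim: s d => [|x s IH] d dm.
  rewrite !big_nil coef1; case: d {dm} => [|d]; last by rewrite expr0n scaler0.
  by rewrite expr0 fact0 invr1 scale1r.
(* Multiplying by one more exponential is the binomial formula, since the binomial coefficient of d
   and e divided by d! is the inverse of e! (d - e)!. *)
rewrite !big_cons coefM addrC exprDn scaler_sumr; apply: eq_bigr => e _.
have ed : (e <= d)%N by rewrite -ltnS.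
rewrite IH ?(leq_trans (leq_subr _ _)) // coef_sum.
rewrite (bigD1 (inord e)) //= inordK ?ltnS ?(leq_trans ed) //.
rewrite big1 ?addr0 => [|j je]; last first.
  rewrite coefCM coefXn [_ == _]negbTE ?mulr0 //; apply: contra je => /eqP ej.
  by rewrite -val_eqE /= inordK ?ltnS ?(leq_trans ed) // ej.
rewrite coefCM coefXn eqxx mulr1.
have ZM (a b : K) (y z : A) : (a *: y) * (b *: z) = (a * b) *: (z * y).
  by rewrite -scalerAl -scalerAr scalerA [y * z]mulrC.
rewrite ZM -scalerMnr scalerMnl -mulr_natr; congr (_ *: _).
rewrite -(bin_fact ed) !natrM.
have nz k : (k`!)%:R != 0 :> K by rewrite pnatr_eq0 -lt0n fact_gt0.
have nb : ('C(d, e))%:R != 0 :> K by rewrite pnatr_eq0 -lt0n bin_gt0.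
by field; rewrite !nz nb.
Qed.

(** Distributing the product of truncated exponentials gives one term per exponent function; the
    coefficient of degree m selects those of sum m. *)
Lemma multinomial (A : comAlgType K) (n m : nat) (x : 'I_n -> A) :
  (\sum_i x i) ^+ m =
    \sum_(l : {ffun 'I_n -> 'I_m.+1} | (\sum_k l k == m)%N)
      ((m`!)%:R / (\prod_k (l k)`!)%:R : K) *: \prod_k x k ^+ l k.
Proof.
have nz k : (k`!)%:R != 0 :> K by rewrite pnatr_eq0 -lt0n fact_gt0.
have := @coef_prod_exp A m [seq x i | i <- index_enum 'I_n] m (leqnn m).
rewrite !big_map /= => /(congr1 (fun y : A => ((m`!)%:R : K) *: y)).
rewrite /= scalerA divff // scale1r => <-.
rewrite bigA_distr_bigA /= coef_sum scaler_sumr [RHS]big_mkcond /=.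
apply: eq_bigr => l _.
rewrite big_split /= -rmorph_prod /= coefCM -expr_sum coefXn eq_sym.
case: eqP => _; last by rewrite mulr0 scaler0.
rewrite mulr1 scaler_prod /= scalerA natr_prod -prodfV; congr (_ *: _).
Qed.

Lemma coef_multinomial (n m d : nat) (c : nat -> K) :
  ((\sum_(k < n) c k *: 'X^(k.+1)) ^+ m)`_d =
    \sum_(l : {ffun 'I_n -> 'I_m.+1} |
           (\sum_k l k == m)%N && (\sum_(k < n) k * l k + m == d)%N)
      ((m`!)%:R / (\prod_k (l k)`!)%:R) * \prod_(k < n) c k ^+ l k.
Proof.
rewrite multinomial coef_sum big_mkcondr /=; apply: eq_bigr => l /eqP hl.
under [X in _ *: X]eq_bigr do rewrite exprZn -exprM.
rewrite scaler_prod scalerA coefZ -expr_sum coefXn.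
have -> : (\sum_(k < n) k.+1 * l k = \sum_(k < n) k * l k + m)%N.
  by rewrite -[X in (_ + X)%N]hl -big_split /=; apply: eq_bigr => k _; rewrite mulSn addnC.
by rewrite eq_sym; case: eqP; rewrite ?mulr1 ?mulr0.
Qed.

End Multinomial.

(** * Convolution with a primitive functional *)

Section Convolution.
Variable K : numFieldType.
Implicit Types (alpha beta H : {scalar FdB K}) (m p q : {cmonom nat}).

Local Notation U m := (mkmalgU m 1 : FdB K).

(** The Leibniz rule for the right-hand side of the equation: the two remaining factors are
    convolutions with the counit, hence values of [H] itself. *)
Lemma conv_derivation alpha H p q :
  (forall p q, alpha (U (mmul p q)) =
     alpha (U p) * counit K (U q) + counit K (U p) * alpha (U q)) ->
  (forall p' q', (wdeg p' + wdeg q' < wdeg p + wdeg q)%N ->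
     H (U (mmul p' q')) = H (U p') * H (U q')) ->
  conv alpha H (U (mmul p q)) =
    conv alpha H (U p) * H (U q) + H (U p) * conv alpha H (U q).
Proof.
move=> der hM; apply: (etrans (convU alpha H _)); rewrite Delta_monoM.
apply: (etrans (mmap_derivation (Delta_mono_homog K p) (Delta_mono_homog K q) der hM)).
congr (_ * _ + _ * _).
- exact/esym/convU.
- exact: mmap_counit_Delta.
- exact: mmap_counit_Delta.
- exact/esym/convU.
Qed.

(** A product of two monomials other than 1 has at least two factors, so it is never a generator,
    and the hypothesis makes [alpha] vanish off the generators. In degree 0 the predecessor is
    harmless, as [mone] is no generator either. *)
Lemma primitive_derivation alpha (c : nat -> K) :
  (forall m, alpha (U m) = c (wdeg m) * (m == ucm (wdeg m).-1)%:R) ->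
  forall p q, alpha (U (mmul p q)) =
     alpha (U p) * counit K (U q) + counit K (U p) * alpha (U q).
Proof.
move=> h p q.
suff gen (A B : {cmonom nat} -> K) :
    (forall m, A m = c (wdeg m) * (m == ucm (wdeg m).-1)%:R) ->
    (forall m, B m = (m == mone)%:R) -> A (mmul p q) = A p * B q + B p * A q.
  exact: (gen (fun m => alpha (U m)) (fun m => counit K (U m)) h (counitlU K)).
move=> {}h hB; rewrite !h !hB.
have one j : (@mone {cmonom nat} == ucm j) = false.
  by apply/negbTE/eqP => /(congr1 (@wdeg)); rewrite wdeg1 wdegU.
have [->|p1] := eqVneq p mone; first by rewrite mul1m one !(mulr0, mul0r, mul1r, add0r).
have [->|q1] := eqVneq q mone; first by rewrite mulm1 !(mulr0, mul0r, mulr1, addr0).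
rewrite mulr0 mul0r addr0; case: eqP => [/(congr1 (@mdeg _))|_]; last by rewrite mulr0.
rewrite mdegM mdegU => /eqP; move: p1 q1; rewrite -!mdeg_eq0.
by case: (mdeg p) (mdeg q) => [|[|?]] [|?].
Qed.

Lemma character_inner_sum H (i j : nat) : (j <= i)%N ->
  H 1 = 1 -> (forall x y, H (x * y) = H x * H y) ->
  H (inner_sum K i j) =
    ((\sum_(k < i.+1) H (t_ K k) *: 'X^(k.+1)) ^+ j.+1)`_i.+1.
Proof.
move=> ji H1 HM; rewrite (coef_multinomial _ _ _ (fun k => H (t_ K k))).
rewrite /inner_sum raddf_sum; apply: eq_big => [l|l _].
  (* The truncated subtraction i - j matches the equation of degrees because j <= i. *)
  apply: andb_id2l => _; rewrite addnS eqSS.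
  move: (\sum_(k < i.+1) k * l k)%N => n.
  by apply/eqP/eqP => [->|<-]; rewrite ?subnK ?addnK.
etransitivity; first exact: scalarZ.
congr (_ * _); rewrite (big_morph _ HM H1) big_mkcond; apply: eq_bigr => k _.
have HX x e : H (x ^+ e) = H x ^+ e.
  by elim: e => [|e IH]; rewrite ?expr0 // !exprS HM IH.
(* The coproduct omits the index 0, the multinomial formula does not; the extra factor is a power of
   [H 1 = 1]. *)
by case: (k : nat) => [|k'] /=; rewrite ?HX // H1 expr1n.
Qed.

(** On a character, the linear equation in the dual becomes the nonlinear Abel equation, read off
    coefficient by coefficient: the right-hand side is the coefficient of r^(i+1) in the sum of the
    c_j v^(j+1). *)
Lemma conv_character_t alpha (c : nat -> K) H i : (0 < i)%N ->
  (forall m, alpha (U m) = c (wdeg m) * (m == ucm (wdeg m).-1)%:R) ->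
  H 1 = 1 -> (forall x y, H (x * y) = H x * H y) ->
  conv alpha H (t_ K i) = \sum_(1 <= j < i.+1)
    c j * ((\sum_(k < i.+1) H (t_ K k) *: 'X^(k.+1)) ^+ j.+1)`_i.+1.
Proof.
move=> i0 ha H1 HM; rewrite conv_t // -(big_mkord xpredT
  (fun j => alpha (t_ K j) * H (inner_sum K i j))) big_ltn //.
have -> : alpha (t_ K 0) = 0.
  rewrite t_U ha wdeg1; case: eqP => [/(congr1 (@wdeg))|_]; last by rewrite mulr0.
  by rewrite wdeg1 wdegU.
rewrite mul0r add0r; apply: eq_big_nat => j /andP[j0 ji].
rewrite character_inner_sum //; congr (_ * _).
by case: j j0 {ji} => // j _; rewrite ha wdegU eqxx mulr1.
Qed.

(** The triangularity of the system: since [alpha] kills 1, its argument takes away at least one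
    degree from that of [H]. *)
Lemma conv_eq alpha H H' m :
  alpha (U mone) = 0 ->
  (forall q, (wdeg q < wdeg m)%N -> H (U q) = H' (U q)) ->
  conv alpha H (U m) = conv alpha H' (U m).
Proof.
move=> a0 h; apply: (etrans (convU alpha H m)); apply: (etrans _ (esym (convU alpha H' m))).
rewrite (mmap_homog (r := [:: tt]) (c := fun=> 1) (alphas := fun=> alpha)
  (hs := fun=> fun q => H' (U q)) (Delta_mono_homog K m)).
  by rewrite big_seq1 mul1r.
move=> p q pq; rewrite big_seq1 mul1r.
have [/wdeg_eq0 ->|p0] := eqVneq (wdeg p) 0%N; first by rewrite a0 !mul0r.
by rewrite h // -pq -[ltnLHS]add0n ltn_add2r lt0n.
Qed.

Lemma conv1 alpha H : alpha (U mone) = 0 -> conv alpha H (U mone) = 0.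
Proof.
move=> a0; apply: (etrans (convU alpha H mone)).
rewrite (mmap_homog (r := [::] : seq unit) (c := fun=> 0) (alphas := fun=> alpha)
  (hs := fun=> fun q => 0) (Delta_mono_homog K mone)); first by rewrite big_nil.
move=> p q; rewrite wdeg1 big_nil => /eqP; rewrite addn_eq0 => /andP[/eqP/wdeg_eq0 -> _].
by rewrite a0 mul0r.
Qed.

Lemma character_ext H : H (U mone) = 1 ->
  (forall p q, H (U (mmul p q)) = H (U p) * H (U q)) -> is_character H.
Proof.
move=> H1 HM; split=> [|x y]; first exact: H1.
rewrite malgME raddf_sum (scalarE H x) (scalarE H y) mulr_suml.
apply: eq_bigr => p _; rewrite raddf_sum mulr_sumr.
apply: eq_bigr => q _.
have -> : mkmalgU (mmul p q) (mcoeff p x * mcoeff q y) =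
    (mcoeff p x * mcoeff q y) *: U (mmul p q) :> FdB K.
  by rewrite -mul_malgC malgM_def fgmulUU mulr1 mul1m.
apply: (etrans (scalarZ H _ _)); rewrite -mulrA mulrCA; rewrite mulrCA.
rewrite -[RHS]mulrA; congr (_ * _).
by rewrite mulrCA; congr (_ * _); exact: HM.
Qed.

End Convolution.

(** * Lipschitz functions and their almost everywhere derivatives *)

Section ComplexNorm.
Variable R : realType.
Local Notation C := (R[i]).
Local Notation nc := (@Normc.normc R).
Implicit Types (z w : C).

Lemma normcD_le z w : nc (z + w) <= nc z + nc w.
Proof. exact: (le_normcD (z : Rcomplex R) w). Qed.

Lemma normcNE z : nc (- z) = nc z.
Proof. exact: (normcN (z : Rcomplex R)). Qed.

Lemma normc_ge0 z : 0 <= nc z.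
Proof. by case: z => x y; exact: sqrtr_ge0. Qed.

Lemma normcB_sym z w : nc (z - w) = nc (w - z).
Proof. by rewrite -normcNE opprB. Qed.

Lemma normc0E : nc 0 = 0.
Proof. exact: Normc.normc0. Qed.

Lemma normc_dist z w u : nc (z - w) <= nc (z - u) + nc (u - w).
Proof. by rewrite (le_trans _ (normcD_le _ _)) // addrA subrK. Qed.

Lemma normcB_le z w : nc (z - w) <= nc z + nc w.
Proof. by rewrite (le_trans (normcD_le _ _)) // normcNE. Qed.

Lemma normcX z n : nc (z ^+ n) = nc z ^+ n.
Proof.
by elim: n => [|n IH]; rewrite ?expr0 ?Normc.normc1 // !exprS Normc.normcM IH.
Qed.

Lemma normc_sum (I : Type) (r : seq I) (P : pred I) (F : I -> C) :
  nc (\sum_(i <- r | P i) F i) <= \sum_(i <- r | P i) nc (F i).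
Proof.
apply: (big_ind2 (fun z x => nc z <= x)) => //; first by rewrite normc0E.
by move=> z x w y zx wy; rewrite (le_trans (normcD_le _ _)) // lerD.
Qed.

Lemma normcR (x : R) : nc (x%:C)%C = `|x|.
Proof. by rewrite /= expr0n addr0 sqrtr_sqr. Qed.

Lemma normc_Re z : `|complex.Re z| <= nc z.
Proof. by rewrite -lecR; exact: normc_ge_Re. Qed.

Lemma normc_Im z : `|complex.Im z| <= nc z.
Proof.
case: z => x y /=; rewrite -sqrtr_sqr ler_sqrt ?addr_ge0 ?sqr_ge0 //.
by rewrite lerDr sqr_ge0.
Qed.

Lemma normc_le_ReIm z : nc z <= `|complex.Re z| + `|complex.Im z|.
Proof.
case: z => x y; rewrite [X in nc X](_ : _ = (x%:C + 'i * y%:C)%C); last by simpc.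
rewrite (le_trans (normcD_le _ _)) // Normc.normcM !normcR.
by rewrite /= expr0n expr1n add0r sqrtr1 mul1r.
Qed.

Lemma ReB z w : complex.Re (z - w) = complex.Re z - complex.Re w.
Proof. by case: z w => ? ? []. Qed.

Lemma ImB z w : complex.Im (z - w) = complex.Im z - complex.Im w.
Proof. by case: z w => ? ? []. Qed.

Lemma ReMr z (x : R) : complex.Re (z * x%:C%C) = complex.Re z * x.
Proof. by case: z => a b /=; rewrite mulr0 subr0. Qed.

Lemma ImMr z (x : R) : complex.Im (z * x%:C%C) = complex.Im z * x.
Proof. by case: z => a b /=; rewrite mulr0 add0r. Qed.

(** Increments instead of quotients: the bound makes sense at [y = x], adds up over real and
    imaginary parts, and passes to limits of functions. *)
Lemma is_derive_epsP (f : R -> R) (x l : R) :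
  is_derive x (1 : R) f l <->
  forall e, 0 < e -> exists2 d, 0 < d &
    forall y, `|y - x| < d -> `|f y - f x - l * (y - x)| <= e * `|y - x|.
Proof.
have E : (forall e, 0 < e -> exists2 d, 0 < d &
    forall y, `|y - x| < d -> `|f y - f x - l * (y - x)| <= e * `|y - x|) <->
    (fun h : R => h^-1 *: ((f \o shift x) (h *: (1 : R)) - f x)) @ 0^' --> (l : R).
  split=> [H|H].
    apply/cvgrPdist_le => e e0; have [d d0 Hd] := H e e0.
    near=> h.
    have h0 : h != 0 by near: h; exact: nbhs_dnbhs_neq.
    have hd : `|h| < d by near: h; apply: dnbhs0_lt.
    have := Hd (h + x); rewrite addrK => /(_ hd).
    rewrite -ler_pdivrMr ?normr_gt0 // -normf_div /= [h *: _]mulr1.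
    rewrite distrC; apply: le_trans; rewrite le_eqVlt; apply/orP; left.
    by apply/eqP; congr (`|_|); rewrite mulrBl mulfK // mulrC.
  move=> e e0; have /cvgrPdist_le/(_ e e0) := H.
  move=> [d /= d0 Hd]; exists d => // y yd.
  have [->|yx] := eqVneq y x; first by rewrite !subrr mulr0 subrr !normr0 mulr0.
  have yx0 : y - x != 0 by rewrite subr_eq0.
  have := Hd (y - x); rewrite /= sub0r normrN => /(_ yd yx0).
  rewrite [_ *: (1 : R)]mulr1 subrK distrC -ler_pdivrMr ?normr_gt0 // -normf_div.
  apply: le_trans; rewrite le_eqVlt; apply/orP; left.
  by apply/eqP; congr (`|_|); rewrite mulrBl mulfK // mulrC.
apply: (iff_trans _ (iff_sym E)); split=> [[dv <-]|H]; first exact: dv.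
split; first by apply/cvg_ex; exists l.
by apply/cvg_lim => //; exact: Rhausdorff.
Unshelve. all: by end_near. Qed.

Lemma cderivP (v : R -> C) x l :
  cderiv v x l <->
  forall e, 0 < e -> exists2 d, 0 < d &
    forall y, `|y - x| < d -> nc (v y - v x - l * (y - x)%:C%C) <= e * `|y - x|.
Proof.
split=> [[/is_derive_epsP H1 /is_derive_epsP H2] e e0|H].
  have e20 : 0 < e / 2 by rewrite divr_gt0.
  have [d1 d10 {}H1] := H1 _ e20; have [d2 d20 {}H2] := H2 _ e20.
  exists (Num.min d1 d2); first by rewrite lt_min d10.
  move=> y; rewrite lt_min => /andP[/H1 {}H1 /H2 {}H2].
  rewrite (le_trans (normc_le_ReIm _)) // !(ReB, ImB) ReMr ImMr.
  by rewrite (le_trans (lerD H1 H2)) // -mulrDl -splitr.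
split; apply/is_derive_epsP => e e0; have [d d0 {}H] := H e e0;
  exists d => // y /H {}H.
  by rewrite -ReMr -!ReB (le_trans (normc_Re _)).
by rewrite -ImMr -!ImB (le_trans (normc_Im _)).
Qed.

End ComplexNorm.

(** Let s be the supremum of the points up to which [P] holds: the first hypothesis reaches s and
    the second would go beyond it if s < b. The first one also gives the base case, being vacuous
    below a. *)
Lemma interval_induction (R : realType) (a b : R) (P : R -> Prop) :
  (forall x, a <= x <= b -> (forall y, a <= y < x -> P y) -> P x) ->
  (forall x, a <= x < b -> (forall y, a <= y <= x -> P y) ->
     exists2 e, 0 < e & forall y, x < y < x + e -> y <= b -> P y) ->
  forall x, a <= x <= b -> P x.
Proof.
move=> Pcl Pop x0 /andP[ax0 x0b].
have ab := le_trans ax0 x0b.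
pose S := [set x | a <= x <= b /\ forall y, a <= y <= x -> P y].
have Pa : P a by apply: Pcl => [|y]; rewrite ?lexx //= => /andP[/le_lt_trans h /h]; rewrite ltxx.
have Sa : S a.
  split; first by rewrite lexx.
  by move=> y ay; have <- : a = y by apply/eqP; rewrite eq_le.
have Sub : has_ubound S by exists b => x [/andP[]].
have supS : has_sup S by split => //; exists a.
pose s := sup S.
have as_ : a <= s by exact: ub_le_sup.
have sb : s <= b by apply: ge_sup; [exists a|move=> x [/andP[]]].
have Plt y : a <= y < s -> P y.
  move=> /andP[ay ys]; have sy0 : 0 < s - y by rewrite subr_gt0.
  have [x [_ Sx]] := sup_adherent sy0 supS.
  by rewrite subKr => yx; apply: Sx; rewrite ay ltW.
have Ps : P s by apply: Pcl; rewrite ?as_.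
have Ple y : a <= y <= s -> P y.
  by move=> /andP[ay]; rewrite le_eqVlt => /orP[/eqP -> //|ys]; apply: Plt; rewrite ay.
suff sE : s = b by apply: Ple; rewrite ax0 sE.
apply/eqP; rewrite eq_le sb leNgt; apply/negP => ltsb.
have [e e0 He] := Pop s ltac:(by rewrite as_) Ple.
pose t := Num.min b (s + e / 2).
have st : s < t by rewrite lt_min ltsb ltrDl divr_gt0.
suff : S t by move=> /(ub_le_sup Sub); rewrite leNgt st.
split; first by rewrite (le_trans as_ (ltW st)) ge_min lexx.
move=> y /andP[ay yt]; have [ys|sy] := leP y s; first by apply: Ple; rewrite ay.
apply: He; last by rewrite (le_trans yt) // ge_min lexx.
rewrite sy (le_lt_trans yt) // gt_min ltrD2l ltr_pdivrMr // ltr_pMr // ltr1n orbT //.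
Qed.

Section Growth.
Variable R : realType.
Local Notation C := (R[i]).
Local Notation mu := (@lebesgue_measure R).
Local Notation nc := (@Normc.normc R).

Lemma null_open_cover (N : set R) (e : R) : measurable N -> mu N = 0%E -> 0 < e ->
  exists U, [/\ open U, N `<=` U & (mu U <= e%:E)%E].
Proof.
move=> mN N0 e0; have Noo : (mu N < +oo)%E by rewrite [X in (X < _)%E]N0 ltry.
have [U [oU NU Ue]] := lebesgue_regularity_outer mN Noo e0.
exists U; split=> //; have mU : measurable U by exact: open_measurable.
rewrite (measureDI mu mU mN) -[e%:E]adde0 leeD // ?(ltW Ue) // -[X in (_ <= X)%E]N0.
by apply: le_measure; rewrite ?inE //; exact: measurableI.
Qed.

(* Cover the exceptional null set by an open set U of measure at most e: outside U the
   derivative controls f, and inside U the Lipschitz bound costs at most L * mu U. *)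
Lemma lipschitz_growth (a b L B : R) (f : R -> C) : a <= b -> 0 <= L -> 0 <= B ->
  (forall x y, a <= x <= b -> a <= y <= b -> nc (f x - f y) <= L * `|x - y|) ->
  {ae mu, forall x, a < x < b -> exists2 l, nc l <= B & cderiv f x l} ->
  nc (f b - f a) <= B * (b - a).
Proof.
move=> ab L0 B0 lip [N0 [mN0 N00 subN]].
apply/ler_addgt0Pr => e' e'0.
(* The total error will be e (b - a) from the derivatives plus L e from the cover, which is at most
   [e']. *)
pose e := e' / (b - a + L + 1).
have D0 : 0 < b - a + L + 1 by rewrite ltr_pwDr // addr_ge0 // subr_ge0.
have e0 : 0 < e by rewrite divr_gt0.
(* No derivative is assumed at a; with a in the null set, the induction starts inside the cover. *)
pose N := N0 `|` [set a].
have mN : measurable N by apply: measurableU.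
have N0E : mu N = 0%E.
  apply/eqP; rewrite -measure_le0 (le_trans (measureU2 _ _ _)) //.
  by rewrite [X in (X + _)%E]N00 [X in (_ + X)%E](lebesgue_measure_set1 a) adde0.
have [U [oU NU Ue]] := null_open_cover mN N0E e0.
have mU : measurable U by exact: open_measurable.
pose phi x y := fine (mu (U `&` `]x, y])).
have mI x y : measurable (U `&` `]x, y]) by exact: measurableI.
have leU x y : (mu (U `&` `]x, y]) <= e%:E)%E.
  apply: (le_trans _ Ue); apply: le_measure; rewrite ?inE; [exact: mI|exact: mU|exact: subIsetl].
have fin x y : mu (U `&` `]x, y]) \is a fin_num.
  by rewrite ge0_fin_numE // (le_lt_trans (leU x y)) // ltry.
have phi0 x y : 0 <= phi x y by rewrite fine_ge0.
have phiD x y z : x <= y -> y <= z -> phi x z = phi x y + phi y z.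
  move=> xy yz.
  have E : U `&` `]x, z] = (U `&` `]x, y]) `|` (U `&` `]y, z]).
    by rewrite -setIUr (@itv_bndbnd_setU _ _ _ (BRight y)) ?bnd_simp.
  rewrite /phi E -fineD //; congr fine; apply: measureU; [exact: mI|exact: mI|].
  apply/seteqP; split=> t; last by [].
  move=> [[_ /=]]; rewrite in_itv /= => /andP[_ ty] [_ /=].
  by rewrite in_itv /= ltNge ty.
have phiE x y : x <= y -> `]x, y] `<=` U -> phi x y = y - x.
  move=> xy sub; rewrite /phi (_ : U `&` _ = `]x, y]%classic); last first.
    by apply/seteqP; split => t; [case|move=> h; split=> //; exact: sub].
  rewrite lebesgue_measure_itv /= lte_fin.
  move: xy; rewrite le_eqVlt => /orP[/eqP ->|->]; last by rewrite -EFinB.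
  by rewrite ltxx subrr.
pose P y := nc (f y - f a) <= (B + e) * (y - a) + L * phi a y.
suff : P b.
  move=> /le_trans; apply; rewrite mulrDl -addrA lerD2l.
  rewrite (le_trans (lerD (lexx _) (ler_wpM2l L0 (_ : phi a b <= e)))) //.
    by rewrite -lee_fin fineK.
  rewrite [L * e]mulrC -mulrDr /e -mulrA ler_piMr ?(ltW e'0) // mulrC ler_pdivrMr // mul1r.
  by rewrite lerDl.
apply: (@interval_induction _ a b P) => [x /andP[ax xb] H|x /andP[ax xb] H|];
  last by rewrite ab lexx.
- have [->|xa] := eqVneq x a; first by rewrite /P !subrr normc0E mulr0 add0r mulr_ge0.
  have {}ax : a < x by rewrite lt_neqAle eq_sym xa.
  apply/ler_addgt0Pr => d d0.
  (* Close enough to x for the Lipschitz bound to cost at most d, and still to the right of a. *)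
  pose y := Num.max a (x - d / (L + 1)).
  have L10 : 0 < L + 1 by rewrite ltr_wpDl.
  have yx : y < x by rewrite gt_max ax gtrBl divr_gt0.
  have ay : a <= y by rewrite le_max lexx.
  have := H y; rewrite ay yx => /(_ isT) Py.
  rewrite (le_trans (normc_dist _ _ (f y))) // addrC lerD //.
    rewrite (le_trans Py) // lerD //.
      by rewrite ler_wpM2l ?addr_ge0 ?(ltW e0) // lerD2r ltW.
    by rewrite ler_wpM2l // (phiD a y x ay (ltW yx)) lerDl.
  rewrite (le_trans (lip _ _ _ _)) ?(ltW ax) ?xb ?ay ?(le_trans (ltW yx)) //.
  rewrite gtr0_norm ?subr_gt0 //.
  have : x - y <= d / (L + 1) by rewrite lerBlDr -lerBlDl le_max lexx orbT.
  move=> /(ler_wpM2l L0)/le_trans; apply.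
  by rewrite mulrCA ler_piMr ?(ltW d0) // ler_pdivrMr // mul1r lerDl.
- have Px : P x by apply: H; rewrite ax lexx.
  have step y (xy : x < y) : nc (f y - f x) <= (B + e) * (y - x) + L * phi x y -> P y.
    move=> h; rewrite /P (phiD a x y ax (ltW xy)).
    rewrite (le_trans (normc_dist _ _ (f x))) // (le_trans (lerD h Px)) //.
    rewrite le_eqVlt; apply/orP; left; apply/eqP; ring.
  have Be : 0 <= B + e by rewrite addr_ge0 // ltW.
  have [xU|xU] := pselect (U x).
    have [d /= d0 Hd] : \forall y \near x, U y by exact: open_nbhs_nbhs.
    exists d => // y /andP[xy yd] yb; apply: (step _ xy).
    rewrite (phiE x y) ?(ltW xy) //; last first.
      move=> t /=; rewrite in_itv /= => /andP[xt ty]; apply: Hd => /=.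
      rewrite ltr_distlC (lt_trans _ xt) ?gtrBl //=.
      by rewrite (le_lt_trans ty).
    rewrite (le_trans (lip _ _ _ _)) ?ax ?(ltW xb) ?yb ?(le_trans ax (ltW xy)) //.
    by rewrite gtr0_norm ?subr_gt0 // lerDr mulr_ge0 // subr_ge0 ltW.
  have xN0 : ~ N0 x by move=> h; apply: xU; apply: NU; left.
  have xa : a < x.
    rewrite lt_neqAle ax andbT; apply/eqP => xa; apply: xU; apply: NU; right.
    by rewrite -xa.
  have /(_ _)[|l lB /cderivP/(_ e e0)[d d0 Hd]] : a < x < b -> exists2 l, nc l <= B & cderiv f x l.
    by apply: contrapT => h; apply: xN0; apply: subN.
    by rewrite xa.
  exists d => // y /andP[xy yd] yb; apply: (step _ xy).
  have xy0 : `|y - x| = y - x by rewrite gtr0_norm // subr_gt0.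
  have := Hd y; rewrite xy0 ltrBlDl => /(_ yd) h.
  rewrite -[f y - f x](subrK (l * (y - x)%:C%C)) (le_trans (normcD_le _ _)) //.
  rewrite Normc.normcM normcR xy0.
  have h2 : nc l * (y - x) <= B * (y - x) by rewrite ler_wpM2r // subr_ge0 ltW.
  have h3 : 0 <= L * phi x y by rewrite mulr_ge0.
  apply: (le_trans (lerD h h2)); rewrite addrC -mulrDl.
  by rewrite lerDl.
Qed.

End Growth.

(** * Primitives of bounded measurable functions *)

Section FundamentalTheorem.
Variable R : realType.
Local Notation C := (R[i]).
Local Notation mu := (@lebesgue_measure R).
Local Notation nc := (@Normc.normc R).
Local Notation I_ T := (`[0, T]%classic : set R).

Lemma lipschitz_measurable (A : set R) (L : R) (u : R -> R) : measurable A ->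
  (forall x y, A x -> A y -> `|u x - u y| <= L * `|x - y|) -> measurable_fun A u.
Proof.
move=> mA lip; apply: subspace_continuous_measurable_fun => //.
apply/subspace_continuousP => x Ax; apply/cvgrPdist_le => e e0.
have L0 : 0 < `|L| + 1 by rewrite ltr_wpDl.
rewrite near_withinE; exists (e / (`|L| + 1)) => /=; first by rewrite divr_gt0.
move=> y xy Ay; rewrite (le_trans (lip _ _ Ax Ay)) //.
rewrite (le_trans (ler_wpM2r (normr_ge0 _) (_ : L <= `|L| + 1))) //.
  by rewrite (le_trans (ler_norm L)) // lerDl.
by rewrite mulrC -ler_pdivlMr // ltW.
Qed.

Lemma ae_imp (P Q : R -> Prop) : (forall x, P x -> Q x) ->
  {ae mu, forall x, P x} -> {ae mu, forall x, Q x}.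
Proof. exact: (@filterS _ _ (ae_filter_ringOfSetsType mu)). Qed.

Lemma ae_imp2 (P Q S : R -> Prop) : (forall x, P x -> Q x -> S x) ->
  {ae mu, forall x, P x} -> {ae mu, forall x, Q x} -> {ae mu, forall x, S x}.
Proof. exact: (@filterS2 _ _ (ae_filter_ringOfSetsType mu)). Qed.

Section Real.
Variables (T B : R) (g : R -> R).
Hypothesis B0 : 0 <= B.
Hypothesis mg : measurable_fun (I_ T : set (measurableTypeR R)) g.
Hypothesis gB : {ae mu, forall x, I_ T x -> `|g x| <= B}.

(** The bound on [g] holds only almost everywhere and only on the interval. Cut down to the set
    where it holds, [g] becomes a function bounded and integrable on the whole line, with the same
    integrals up to T. *)
Let A := I_ T `&` (fun x => `|g x|) @^-1` `]-oo, B].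
Let g1 := g \_ A.

Let mA : measurable (A : set (measurableTypeR R)).
Proof. by apply: (measurableT_comp _ mg) => //; exact: measurable_normr. Qed.

Let intA : mu.-integrable A (EFin \o g).
Proof.
apply: measurable_bounded_integrable => //.
- apply: (@le_lt_trans _ _ (mu (I_ T))).
    by apply: le_measure; rewrite ?inE //; exact: subIsetl.
  by rewrite lebesgue_measure_itv /=; case: ifP => _; rewrite ?ltry.
- by apply: measurable_funS mg => //; exact: subIsetl.
- exists B; split; rewrite ?num_real // => b Bb x [_ /=].
  by rewrite in_itv /= => /le_trans; apply; exact: ltW.
Qed.

Let intg1 (D : set (measurableTypeR R)) : measurable D -> mu.-integrable D (EFin \o g1).
Proof.
move=> mD; move: intA; rewrite integrable_mkcond // restrict_EFin => h.
exact: (integrableS measurableT mD _ h).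
Qed.

Let g1B x : `|g1 x| <= B.
Proof.
rewrite /g1 patchE; case: ifPn => [|_]; last by rewrite normr0.
by rewrite inE => -[_ /=]; rewrite in_itv.
Qed.

Let Fg1 x : x <= T -> \int[mu]_(t in I_ x) g t = \int[mu]_(t in I_ x) g1 t.
Proof.
move=> xT; rewrite /Rintegral; congr fine; apply: ae_eq_integral => //.
- apply/measurable_EFinP; apply: measurable_funS mg => //.
  by apply: subset_itvl; rewrite bnd_simp.
- by case/integrableP: (intg1 (@measurable_itv _ `[0, x])).
- move: gB; apply: ae_imp => t h xt.
  have Tt : I_ T t.
    by move: xt; rewrite /= !in_itv /= => /andP[-> /le_trans ->].
  rewrite /g1 /= patchE mem_set //; split=> //=.
  by rewrite in_itv /=; exact: h.
Qed.

Lemma Rintegral_lipschitz x y : I_ T x -> I_ T y ->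
  `|\int[mu]_(t in I_ x) g t - \int[mu]_(t in I_ y) g t| <= B * `|x - y|.
Proof.
wlog yx : x y / y <= x.
  move=> h Ix Iy; have [/h|/ltW/h h'] := leP y x; first exact.
  by rewrite distrC (distrC x y); exact: h'.
rewrite /= !in_itv /= => /andP[x0 xT] /andP[y0 yT].
rewrite !Fg1 // Rintegral_itvB ?bnd_simp //; last exact: intg1.
rewrite (le_trans (le_normr_Rintegral _ _)) //; first exact: intg1.
apply: (@le_trans _ _ (\int[mu]_(t in `]y, x]) B)).
  apply: le_Rintegral => //; first exact: (integrable_norm (intg1 _)).
  have yxoo : (mu `]y, x] < +oo)%E.
    by rewrite lebesgue_measure_itv /=; case: ifP => _; rewrite ?ltry.
  by apply: measurable_bounded_integrable => //; exact: bounded_cst.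
rewrite Rintegral_cst //; apply: ler_wpM2l => //.
have -> : fine (mu `]y, x]) = if y < x then x - y else 0.
  by rewrite lebesgue_measure_itv /= lte_fin; case: ifP.
by rewrite ger0_norm ?subr_ge0 //; case: ifP; rewrite // subr_ge0.
Qed.

Lemma Rintegral_derive :
  {ae mu, forall x, 0 < x < T -> is_derive x (1 : R) (fun y => \int[mu]_(t in I_ y) g t) (g x)}.
Proof.
have := FTC1 (a := BLeft 0) (fun y => intg1 (measurable_itv _)) (integrable_locally mA intA).
move: gB; apply: ae_imp2 => x gx dx /andP[x0 xT].
have [d1 d2] := dx x0.
have dg : is_derive x (1 : R) (fun y => \int[mu]_(t in I_ y) g1 t) (g x).
  have -> : g x = g1 x.
    have Ix : I_ T x by rewrite /= in_itv /= !ltW.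
    by rewrite /g1 patchE mem_set //; split=> //=; rewrite in_itv /=; exact: gx.
  by split; [exact: d1|rewrite -d2 derive1E].
apply/is_derive_epsP => e e0; have /is_derive_epsP/(_ e e0)[d d0 Hd] := dg.
(* The integrals of [g] and of its cut-off agree only up to T, so y must not exceed T. *)
exists (Num.min d (T - x)); first by rewrite lt_min d0 subr_gt0.
move=> y; rewrite lt_min => /andP[yd yT]; rewrite !Fg1 ?Hd ?(ltW xT) //.
by rewrite -(lerD2r (- x)) (le_trans (ler_norm _)) // ltW.
Qed.

End Real.

Lemma cint_ftc (T B : R) (f : R -> C) : 0 <= B -> cmeasurable (I_ T) f ->
  {ae mu, forall x, I_ T x -> nc (f x) <= B} ->
  (forall x y, I_ T x -> I_ T y ->
     nc (cint (I_ x) f - cint (I_ y) f) <= (B + B) * `|x - y|) /\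
  {ae mu, forall x, 0 < x < T -> cderiv (fun y => cint (I_ y) f) x (f x)}.
Proof.
move=> B0 [mRe mIm] fB.
have fRe : {ae mu, forall x, I_ T x -> `|complex.Re (f x)| <= B}.
  by move: fB; apply: ae_imp => x h /h; apply: le_trans; exact: normc_Re.
have fIm : {ae mu, forall x, I_ T x -> `|complex.Im (f x)| <= B}.
  by move: fB; apply: ae_imp => x h /h; apply: le_trans; exact: normc_Im.
split=> [x y Ix Iy|].
  rewrite (le_trans (normc_le_ReIm _)) // ReB ImB mulrDl lerD //.
    exact: (Rintegral_lipschitz B0 mRe fRe Ix Iy).
  exact: (Rintegral_lipschitz B0 mIm fIm Ix Iy).
have := Rintegral_derive mIm fIm; have := Rintegral_derive mRe fRe.
by apply: ae_imp2 => x h1 h2 x0T; split; [exact: h1|exact: h2].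
Qed.

End FundamentalTheorem.

(** * Calculus for complex-valued functions *)

Section ComplexCalculus.
Variable R : realType.
Local Notation C := (R[i]).
Local Notation nc := (@Normc.normc R).
Local Notation I_ T := (`[0, T]%classic : set R).
Implicit Types (u v : R -> C).

Lemma cderiv_cst (z : C) x : cderiv (fun=> z) x 0.
Proof. by split; exact: is_derive_cst. Qed.

Lemma ReD (z w : C) : complex.Re (z + w) = complex.Re z + complex.Re w.
Proof. by case: z w => ? ? []. Qed.

Lemma ImD (z w : C) : complex.Im (z + w) = complex.Im z + complex.Im w.
Proof. by case: z w => ? ? []. Qed.

Lemma cderivD u v x du dv : cderiv u x du -> cderiv v x dv ->
  cderiv (fun y => u y + v y) x (du + dv).
Proof.
move=> [u1 u2] [v1 v2]; split; rewrite (ReD, ImD).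
  have -> : (fun y => complex.Re (u y + v y)) =
    (fun y => complex.Re (u y)) + (fun y => complex.Re (v y)).
    by apply/funext => y; rewrite ReD.
  exact: is_deriveD.
have -> : (fun y => complex.Im (u y + v y)) =
  (fun y => complex.Im (u y)) + (fun y => complex.Im (v y)).
  by apply/funext => y; rewrite ImD.
exact: is_deriveD.
Qed.

Lemma ReM (z w : C) : complex.Re (z * w) =
  complex.Re z * complex.Re w - complex.Im z * complex.Im w.
Proof. by case: z w => ? ? []. Qed.

Lemma ImM (z w : C) : complex.Im (z * w) =
  complex.Re z * complex.Im w + complex.Im z * complex.Re w.
Proof. by case: z w => ? ? []. Qed.

Lemma cderivM u v x du dv : cderiv u x du -> cderiv v x dv ->
  cderiv (fun y => u y * v y) x (du * v x + u x * dv).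
Proof.
move=> [u1 u2] [v1 v2]; split.
  have -> : (fun y => complex.Re (u y * v y)) =
    (fun y => complex.Re (u y)) * (fun y => complex.Re (v y)) -
    (fun y => complex.Im (u y)) * (fun y => complex.Im (v y)).
    by apply/funext => y; rewrite ReM.
  apply: (is_derive_eq (is_deriveB (is_deriveM u1 v1) (is_deriveM u2 v2))).
  rewrite ReD !ReM /GRing.scale /=; ring.
have -> : (fun y => complex.Im (u y * v y)) =
  (fun y => complex.Re (u y)) * (fun y => complex.Im (v y)) +
  (fun y => complex.Im (u y)) * (fun y => complex.Re (v y)).
  by apply/funext => y; rewrite ImM.
apply: (is_derive_eq (is_deriveD (is_deriveM u1 v2) (is_deriveM u2 v1))).
rewrite ImD !ImM /GRing.scale /=; ring.
Qed.

Lemma cderivZ (z : C) v x dv : cderiv v x dv ->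
  cderiv (fun y => z * v y) x (z * dv).
Proof.
move=> h; have := cderivM (cderiv_cst z x) h.
by rewrite mul0r add0r.
Qed.

Lemma cderivB u v x du dv : cderiv u x du -> cderiv v x dv ->
  cderiv (fun y => u y - v y) x (du - dv).
Proof.
move=> hu /(cderivZ (-1)) hv; have := cderivD hu hv.
rewrite mulN1r; congr cderiv; apply/funext => y; by rewrite mulN1r.
Qed.

Lemma cderiv_sum (I : eqType) (r : seq I) (F : I -> R -> C) (dF : I -> C) x :
  (forall i, i \in r -> cderiv (F i) x (dF i)) ->
  cderiv (fun y => \sum_(i <- r) F i y) x (\sum_(i <- r) dF i).
Proof.
elim: r => [|i r IH] h.
  rewrite big_nil; under eq_fun do rewrite big_nil; exact: cderiv_cst.
rewrite big_cons; under eq_fun do rewrite big_cons.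
apply: cderivD; first by apply: h; rewrite mem_head.
by apply: IH => j jr; apply: h; rewrite inE jr orbT.
Qed.

Lemma cderiv_eq v x l l' : cderiv v x l -> l = l' -> cderiv v x l'.
Proof. by move=> h <-. Qed.

Lemma clipschitz_ge0 (D : set R) v : clipschitz D v ->
  exists2 L, 0 <= L & forall x y, D x -> D y -> nc (v x - v y) <= L * `|x - y|.
Proof.
move=> [L h]; exists `|L| => // x y Dx Dy.
by rewrite (le_trans (h _ _ Dx Dy)) // ler_wpM2r // ler_norm.
Qed.

Lemma clipschitz_cst (D : set R) (z : C) : clipschitz D (fun=> z).
Proof. by exists 0 => x y _ _; rewrite subrr normc0E mul0r. Qed.

Lemma clipschitzD (D : set R) u v : clipschitz D u -> clipschitz D v ->
  clipschitz D (fun x => u x + v x).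
Proof.
move=> [K hu] [L hv]; exists (K + L) => x y Dx Dy.
by rewrite opprD addrACA (le_trans (normcD_le _ _)) // mulrDl lerD ?hu ?hv.
Qed.

Lemma clipschitz_bounded (T : R) u : 0 <= T -> clipschitz (I_ T) u ->
  exists2 B, 0 <= B & forall x, I_ T x -> nc (u x) <= B.
Proof.
move=> T0 /clipschitz_ge0[L L0 h]; exists (L * T + nc (u 0)).
  by rewrite addr_ge0 ?normc_ge0 // mulr_ge0.
move=> x Ix; rewrite -[u x](subrK (u 0)) (le_trans (normcD_le _ _)) // lerD2r.
have I0 : I_ T 0 by rewrite /= in_itv /= lexx.
rewrite (le_trans (h _ _ Ix I0)) // ler_wpM2l // subr0.
by move: Ix; rewrite /= in_itv /= => /andP[x0 xT]; rewrite ger0_norm.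
Qed.

Lemma clipschitzM (T : R) u v : 0 <= T -> clipschitz (I_ T) u -> clipschitz (I_ T) v ->
  clipschitz (I_ T) (fun x => u x * v x).
Proof.
move=> T0 hu hv; have [B B0 uB] := clipschitz_bounded T0 hu.
have [B' B'0 vB] := clipschitz_bounded T0 hv.
have [K K0 {}hu] := clipschitz_ge0 hu; have [L L0 {}hv] := clipschitz_ge0 hv.
exists (B * L + K * B') => x y Ix Iy.
have -> : u x * v x - u y * v y = u x * (v x - v y) + (u x - u y) * v y by ring.
rewrite (le_trans (normcD_le _ _)) // !Normc.normcM mulrDl -!mulrA lerD //.
  by rewrite ler_pM ?normc_ge0 ?uB ?hv.
by rewrite [leRHS]mulrA [leRHS]mulrAC ler_pM ?normc_ge0 ?vB ?hu.
Qed.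

Lemma clipschitzZ (T : R) (z : C) v : 0 <= T -> clipschitz (I_ T) v ->
  clipschitz (I_ T) (fun x => z * v x).
Proof. by move=> T0; apply: clipschitzM => //; exact: clipschitz_cst. Qed.

Lemma clipschitzB (T : R) u v : 0 <= T -> clipschitz (I_ T) u -> clipschitz (I_ T) v ->
  clipschitz (I_ T) (fun x => u x - v x).
Proof.
move=> T0 hu /(clipschitzZ (-1) T0) hv.
have -> : (fun x => u x - v x) = (fun x => u x + -1 * v x).
  by apply/funext => x; rewrite mulN1r.
exact: clipschitzD.
Qed.

Lemma clipschitz_sum (I : eqType) (r : seq I) (F : I -> R -> C) (D : set R) :
  (forall i, i \in r -> clipschitz D (F i)) ->
  clipschitz D (fun y => \sum_(i <- r) F i y).
Proof.
elim: r => [|i r IH] h.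
  under eq_fun do rewrite big_nil; exact: clipschitz_cst.
under eq_fun do rewrite big_cons.
apply: clipschitzD; first by apply: h; rewrite mem_head.
by apply: IH => j jr; apply: h; rewrite inE jr orbT.
Qed.

(** The growth estimate with bound 0. All uniqueness statements in the dual come from it, one degree
    at a time. *)
Lemma clipschitz_constant (T : R) v : clipschitz (I_ T) v ->
  {ae @lebesgue_measure R, forall x, 0 < x < T -> cderiv v x 0} ->
  forall x, I_ T x -> v x = v 0.
Proof.
move=> /clipschitz_ge0[L L0 h] dv x; rewrite /= in_itv /= => /andP[x0 xT].
have := @lipschitz_growth R 0 x L 0 v x0 L0 (lexx _).
rewrite mul0r => g; apply/eqP; rewrite -subr_eq0; apply/eqP/Normc.eq0_normc.
apply/eqP; rewrite eq_le normc_ge0 andbT; apply: g.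
  move=> y z /andP[y0 yx] /andP[z0 zx].
  by apply: h; rewrite /= in_itv /= ?y0 ?z0 (le_trans _ xT).
apply: ae_imp dv => y dv /andP[y0 yx]; exists 0; first by rewrite normc0E.
by apply: dv; rewrite y0 (lt_le_trans yx).
Qed.

End ComplexCalculus.

Section AlmostEverywhere.
Variable R : realType.
Local Notation mu := (@lebesgue_measure R).

Lemma ae_countable (I : countType) (P : I -> R -> Prop) :
  (forall i, {ae mu, forall x, P i x}) -> {ae mu, forall x, forall i, P i x}.
Proof.
move=> h; pose F (n : nat) : set R := fun x => ~ forall i, @choice.unpickle I n = Some i -> P i x.
have nF : mu.-negligible (\bigcup_n F n).
  apply: negligible_bigcup => n; rewrite /F.
  case E: (choice.unpickle n) => [i|].
    by apply: negligibleS (h i) => x /= nP Px; apply: nP => _ [<-].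
  by apply: (negligibleS _ (negligible_set0 _)) => x; apply.
rewrite /almost_everywhere /=; apply: negligibleS nF => x /= /existsNP[i Pi].
exists (choice.pickle i) => // /(_ i).
by rewrite choice.pickleK => /(_ erefl).
Qed.

(** [cderiv] is two-sided, so derivatives are computed in the open interval; the endpoints form a
    null set. *)
Lemma ae_interior (T : R) (P : R -> Prop) :
  {ae mu, forall x, 0 < x < T -> P x} ->
  {ae mu, forall x, `[0, T]%classic x -> P x}.
Proof.
move=> h; have n0 (c : R) : mu.-negligible [set c].
  by apply/negligibleP => //; exact: lebesgue_measure_set1.
have h0 : {ae mu, forall x, x <> 0 /\ x <> T}.
  have nn := negligibleU (n0 0) (n0 T).
  rewrite /almost_everywhere /=; apply: negligibleS nn => x /= /not_andP[|] /contrapT ->.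
    by left.
  by right.
apply: ae_imp2 h h0 => x Px [x0 xT]; rewrite /= in_itv /= => /andP[x0' xT'].
apply: Px; rewrite !lt_neqAle x0' xT' !andbT eq_sym.
by apply/andP; split; apply/eqP.
Qed.

End AlmostEverywhere.

(** * Regularity of the iterated integrals *)

Section IteratedIntegrals.
Variable R : realType.
Local Notation C := (R[i]).
Local Notation mu := (@lebesgue_measure R).
Local Notation nc := (@Normc.normc R).
Local Notation I_ T := (`[0, T]%classic : set R).

Lemma in_X_bound (T : R) (a : nat -> R -> C) : in_X T a ->
  exists2 M, 1 <= M &
    {ae mu, forall x, I_ T x -> forall i, (0 < i)%N -> nc (a i x) <= M ^+ i}.
Proof.
move=> [_ [M0 h]]; exists (Num.max M0 1); first by rewrite le_max lexx orbT.
apply: ae_imp h => x h Ix i i0; have {}h := h Ix i i0.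
have -> : nc (a i x) = (nc (a i x) `^ (i%:R^-1)) ^+ i.
  rewrite -powR_mulrn ?powR_ge0 // -powRrM mulVf ?powRr1 ?normc_ge0 //.
  by rewrite pnatr_eq0 -lt0n.
by rewrite lerXn2r ?nnegrE ?powR_ge0 ?le_max ?h // ler01 orbT.
Qed.

Lemma cmeasurableM (D : set R) (u v : R -> C) :
  cmeasurable D u -> cmeasurable D v -> cmeasurable D (fun x => u x * v x).
Proof.
move=> [u1 u2] [v1 v2]; split.
  under eq_fun do rewrite ReM.
  by apply: measurable_funB; apply: measurable_funM.
under eq_fun do rewrite ImM.
by apply: measurable_funD; apply: measurable_funM.
Qed.

Lemma clipschitz_cmeasurable (D : set R) (u : R -> C) : measurable D ->
  clipschitz D u -> cmeasurable D u.
Proof.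
move=> mD [L h]; split; apply: (lipschitz_measurable (L := L)) => // x y Dx Dy.
  by rewrite -ReB (le_trans (normc_Re _)) // h.
by rewrite -ImB (le_trans (normc_Im _)) // h.
Qed.

Lemma cint0 (f : R -> C) : cint (I_ 0) f = 0.
Proof. by rewrite /cint set_itv1 !Rintegral_set1. Qed.

Definition diint (a : nat -> R -> C) (w : seq nat) (x : R) : C :=
  if w is i :: w' then a i x * iint a w' x else 0.

Lemma iint0 (a : nat -> R -> C) w : iint a w 0 = (w == [::])%:R.
Proof. by case: w => [|i w] //=; rewrite cint0. Qed.

Lemma iint_regular (T M : R) (a : nat -> R -> C) (w : seq nat) : 0 < T -> 1 <= M ->
  (forall i, (0 < i)%N -> cmeasurable (I_ T) (a i)) ->
  {ae mu, forall x, I_ T x -> forall i, (0 < i)%N -> nc (a i x) <= M ^+ i} ->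
  all (fun i => 0 < i)%N w ->
  clipschitz (I_ T) (iint a w) /\
  {ae mu, forall x, 0 < x < T -> cderiv (iint a w) x (diint a w x)}.
Proof.
move=> T0 M1 ma aM; elim: w => [_|i w IH] /=.
  split; first exact: clipschitz_cst.
  by apply: ae_imp aM => x _ _; exact: cderiv_cst.
move=> /andP[i0 /IH[lip dw]].
have [B B0 wB] := clipschitz_bounded (ltW T0) lip.
have M0 : 0 <= M by rewrite (le_trans ler01).
have [] := @cint_ftc R T (M ^+ i * B) (fun s => a i s * iint a w s).
- by rewrite mulr_ge0 // exprn_ge0.
- by apply: cmeasurableM; [exact: ma|apply: clipschitz_cmeasurable].
- apply: ae_imp aM => x h Ix; rewrite Normc.normcM ler_pM ?normc_ge0 //.
    exact: h.
  exact: wB.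
by move=> h1 h2; split=> //; exists (M ^+ i * B + M ^+ i * B).
Qed.

End IteratedIntegrals.

(** * The solution of the equation in the dual *)

Section Compositions.

(** [f] is fuel; since parts are at least 1, [f = n] is enough. The head of a word is its outermost
    letter, as in [iint]. *)
Fixpoint comps_rec (f n : nat) : seq (seq nat) :=
  if n is 0%N then [:: [::]] else
  if f is f'.+1 then
    flatten [seq [seq i :: w | w <- comps_rec f' (n - i)] | i <- iota 1 n]
  else [::].

Definition comps (n : nat) : seq (seq nat) := comps_rec n n.

Lemma mem_comps_rec f n (w : seq nat) : (n <= f)%N ->
  (w \in comps_rec f n) = all (fun i => 0 < i)%N w && (sumn w == n).
Proof.
have pos0 (u : seq nat) : all (fun i => 0 < i)%N u && (sumn u == 0%N) = (u == [::]).
  by case: u => [|[|i] u] //=; rewrite andbF.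
elim: f n w => [|f IH] n w; first by rewrite leqn0 => /eqP ->; rewrite pos0 inE.
case: n => [_|n nf]; first by rewrite pos0 inE.
rewrite [comps_rec _ _](erefl : _ =
  flatten [seq [seq i :: w | w <- comps_rec f (n.+1 - i)] | i <- iota 1 n.+1]).
apply/flatten_mapP/andP => [[j]|].
  rewrite mem_iota => /andP[i0 ni] /mapP[w' + ->] /=.
  rewrite IH ?leq_subLR; last by rewrite (leq_trans nf) // -add1n leq_add.
  by move=> /andP[-> /eqP ->]; rewrite i0 subnKC.
case: w => [|i w]; first by case.
rewrite [all _ _]/= [sumn _]/= => -[/andP[i0 aw] /eqP wn].
exists i; first by rewrite mem_iota i0 add1n ltnS -wn leq_addr.
apply/mapP; exists w => //; rewrite IH ?leq_subLR.
  by rewrite aw -wn addKn eqxx.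
by rewrite (leq_trans nf) // -add1n leq_add.
Qed.

Lemma mem_comps n (w : seq nat) :
  (w \in comps n) = all (fun i => 0 < i)%N w && (sumn w == n).
Proof. exact: mem_comps_rec. Qed.

Lemma comps_rec_uniq f n : uniq (comps_rec f n).
Proof.
elim: f n => [|f IH] [|n] //; rewrite [comps_rec _ _]/=.
apply: (@allpairs_uniq_dep _ (fun=> seq nat) _ (fun i w => i :: w) (iota 1 n.+1)
  (fun i => comps_rec f (n.+1 - i))); first exact: iota_uniq.
  by move=> i _; exact: IH.
by move=> [i w] [j u] _ _ /= [-> ->].
Qed.

(** Splits off the outermost letter, which is the one removed when an iterated integral is
    differentiated. *)
Lemma sum_comps (V : zmodType) n (F : seq nat -> V) : (0 < n)%N ->
  \sum_(w <- comps n) F w = \sum_(i <- iota 1 n) \sum_(w <- comps (n - i)) F (i :: w).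
Proof.
move=> n0.
have -> : \sum_(i <- iota 1 n) \sum_(w <- comps (n - i)) F (i :: w) =
    \sum_(w <- flatten [seq [seq i :: w | w <- comps (n - i)] | i <- iota 1 n]) F w.
  by rewrite big_flatten big_map; apply: eq_bigr => i _; rewrite big_map.
apply: perm_big; apply: uniq_perm; first exact: comps_rec_uniq.
  apply: (@allpairs_uniq_dep _ (fun=> seq nat) _ (fun i w => i :: w) (iota 1 n)
    (fun i => comps (n - i))); first exact: iota_uniq.
    by move=> i _; exact: comps_rec_uniq.
  by move=> [i w] [j u] _ _ /= [-> ->].
move=> w; rewrite mem_comps; apply/andP/flatten_mapP => [|[ i ]].
  case: w => [ [_ /eqP h]|i w] /=; first by rewrite -h in n0.
  move=> [/andP[i0 aw] /eqP wn].
  exists i; first by rewrite mem_iota i0 add1n ltnS -wn leq_addr.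
  by apply/mapP; exists w; rewrite // mem_comps aw -wn addKn eqxx.
rewrite mem_iota add1n ltnS => /andP[i0 ni] /mapP[w' + ->] /=.
by rewrite mem_comps => /andP[-> /eqP ->]; rewrite i0 subnKC.
Qed.

(** Translates the indexing of [chen]. Positive parts of sum n are at most n in number and in size,
    so bounded tuples reach every composition; the reversal puts the outermost letter first. *)
Lemma sum_compositions_tuple (V : zmodType) n (F : seq nat -> V) :
  \sum_(k < n.+1)
    \sum_(s : k.-tuple 'I_n.+1 |
          all (fun i : 'I_n.+1 => (0 < i)%N) s && (\sum_(i <- s) i == n)%N)
      F (rev [seq val i | i <- s]) = \sum_(w <- comps n) F w.
Proof.
pose P k (s : k.-tuple 'I_n.+1) :=
  all (fun i : 'I_n.+1 => (0 < i)%N) s && (\sum_(i <- s) i == n)%N.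
pose t k := [seq rev [seq val i | i <- tval s] | s <- enum (@P k)].
transitivity (\sum_(w <- flatten [seq t (val k) | k <- enum 'I_n.+1]) F w).
  rewrite big_flatten big_map big_enum; apply: eq_bigr => k _.
  by rewrite big_map big_enum.
have size_t k w : w \in t k -> size w = k.
  by move=> /mapP[s _ ->]; rewrite size_rev size_map size_tuple.
apply: perm_big; apply: uniq_perm; last 2 first.
- exact: comps_rec_uniq.
- move=> w; rewrite mem_comps; apply/flatten_mapP/andP => [ [k _ /mapP[s]]|[aw /eqP wn]].
    rewrite mem_enum => /andP[a0 /eqP sn] ->; split.
      by rewrite all_rev all_map.
    by rewrite sumn_rev sumnE big_map sn.
  have szw : (size w < n.+1)%N.
    rewrite ltnS -wn; elim: w aw {wn} => //= i w IH /andP[i0 /IH].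
    by rewrite -addn1 addnC; exact: leq_add.
  have wle i : i \in w -> (i < n.+1)%N.
    rewrite ltnS -wn; elim: w {aw wn szw} => //= j w IH; rewrite inE => /orP[/eqP ->|/IH h].
      exact: leq_addr.
    by rewrite (leq_trans h) ?leq_addl.
  pose s := [seq inord i : 'I_n.+1 | i <- rev w].
  have vs : [seq val i | i <- s] = rev w.
    rewrite -map_comp -[RHS]map_id; apply/eq_in_map => i; rewrite mem_rev => iw /=.
    by rewrite inordK // wle.
  have ss : size s == size w by rewrite size_map size_rev.
  exists (Ordinal szw); first by rewrite mem_enum.
  apply/mapP; exists (Tuple ss); last by rewrite /= vs revK.
  rewrite mem_enum; apply/andP; split.
    by rewrite -(all_map val (fun i => 0 < i)%N) vs all_rev.
  by rewrite /= -(big_map val xpredT id) vs -sumnE sumn_rev wn.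
elim: (enum 'I_n.+1) (enum_uniq 'I_n.+1) => //= k ks IH /andP[kks /IH uks].
rewrite cat_uniq uks andbT map_inj_uniq ?enum_uniq; last first.
  by move=> s s' /(can_inj revK)/(inj_map val_inj)/val_inj.
apply/hasPn => w /flatten_mapP[k' k'ks /size_t wk']; apply/negP => /size_t wk.
by move: kks; rewrite (_ : k = k') ?k'ks //; apply: val_inj; rewrite /= -wk -wk'.
Qed.

End Compositions.

(** * The Chen series as a flow in the dual *)

Section ChenSolution.
Variable R : realType.
Local Notation C := (R[i]).
Local Notation mu := (@lebesgue_measure R).
Local Notation nc := (@Normc.normc R).
Local Notation I_ T := (`[0, T]%classic : set R).
Local Notation U m := (mkmalgU m 1 : FdB C).
Variables (T : R) (a : nat -> R -> C).

Lemma FdB_fieldU x m :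
  FdB_field a x (U m) = a (wdeg m) x * (m == ucm (wdeg m).-1)%:R.
Proof.
rewrite /FdB_field /series_dual functionalU.
case E: (wdeg m) => [|n]; rewrite functionalU.
  rewrite (wdeg_eq0 E); case: eqP => [/(congr1 (@wdeg))|_]; last by rewrite mulr0.
  by rewrite wdeg1 wdegU.
by congr (_ * _); rewrite /t_dual functionalU.
Qed.

(** [rho_word] for letters counted from 1 instead of 0. *)
Definition rword (w : seq nat) : {scalar FdB C} :=
  foldr (fun i alpha => conv (t_dual C i) alpha) (counit C) w.

Definition chen_flow (x : R) : {scalar FdB C} :=
  functional (fun m => \sum_(w <- comps (wdeg m)) iint a w x * rword w (U m)).

Lemma chen_flowU x m : chen_flow x (U m) =
  \sum_(w <- comps (wdeg m)) iint a w x * rword w (U m).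
Proof. exact: functionalU. Qed.

(** Differentiating [iint] peels off the outermost letter i with factor [a i x], and [rword] of the
    same word is [t_i'] convolved with that of the rest; summing over i rebuilds the field. *)
Lemma dchen_flowU x m :
  \sum_(w <- comps (wdeg m)) diint a w x * rword w (U m) =
  conv (FdB_field a x) (chen_flow x) (U m).
Proof.
apply: (etrans _ (esym (convU _ _ _))).
pose n := wdeg m.
pose r := [seq (i, w) | i <- iota 1 n, w <- comps (n - i)].
rewrite (mmap_homog (r := r) (c := fun p => a p.1 x * iint a p.2 x)
  (alphas := fun p => t_dual C p.1) (hs := fun p q => rword p.2 (U q))
  (Delta_mono_homog C m)).
  rewrite /r big_allpairs_dep /= -/n.
  have [n0|n0] := posnP n.
    by rewrite n0 /= big_nil /comps /= big_seq1 mul0r.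
  apply: (etrans (sum_comps _ n0)).
  apply: eq_bigr => i _.
  apply: eq_bigr => w _.
  exact: (congr1 (fun z => a i x * iint a w x * z) (convU (t_dual C i) (rword w) m)).
move=> p q pq; rewrite FdB_fieldU chen_flowU /r big_allpairs_dep /=.
have tE i : t_dual C i (U p) = (p == ucm i.-1)%:R by exact: functionalU.
(* Both sides see p only when it is a generator, and then its degree singles out one letter i. *)
have [pE|pN] := eqVneq p (ucm (wdeg p).-1); last first.
  rewrite mulr0 mul0r big_seq big1 // => i; rewrite mem_iota => /andP[i0 _].
  apply: big1 => w _; rewrite tE; case: eqP => [pi|_]; last by rewrite mul0r mulr0.
  by case/eqP: pN; rewrite {1}pi pi wdegU.
have p0 : (0 < wdeg p)%N by rewrite pE wdegU.
rewrite (bigD1_seq (wdeg p)) ?iota_uniq //=; last first.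
  by rewrite mem_iota p0 add1n ltnS /n -pq leq_addr.
rewrite [X in _ = _ + X]big_seq_cond [X in _ = _ + X]big1 ?addr0 => [|i /andP[]]; last first.
  rewrite mem_iota => /andP[i0 _] ip; apply: big1 => w _.
  rewrite tE; case: eqP => [pi|_]; last by rewrite mul0r mulr0.
  by move: ip; rewrite pi wdegU prednK // eqxx.
have -> : (n - wdeg p)%N = wdeg q by rewrite /n -pq addKn.
rewrite mulr1 mulr_sumr; apply: eq_bigr => w _.
by rewrite tE -pE eqxx mul1r mulrA.
Qed.

Lemma rho_chenU m : rho (chen T a) (U m) = chen_flow T (U m).
Proof.
rewrite chen_flowU /rho /series_dual functionalU /rho_free functionalU.
set h := fun w => rho_word C w (U m).
case E: (wdeg m) => [|n].
  rewrite /chen /comps /= big_seq1 mul1r.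
  have -> : (1 : freeX C) = mkmalgU mone 1 by [].
  rewrite mmapU mul1r /h (wdeg_eq0 E) /rho_word.
  by rewrite [fmonom_val _]fm1.
rewrite /chen -(sum_compositions_tuple n.+1 (fun w => iint a w T * rword w (U m))).
rewrite raddf_sum; apply: eq_bigr => k _; rewrite raddf_sum; apply: eq_big => // s _.
rewrite /iterated_integral.
set c := iint a _ T; clearbody c.
have -> : \prod_(i <- rev s) X_ C i =
    mkmalgU (FMonom [seq i.-1 | i <- rev [seq val i | i <- s]]) 1.
  rewrite -map_rev; elim: (rev s) => [|i r IH].
    by rewrite big_nil /= -fmoneE.
  rewrite big_cons IH /X_ malgM_def fgmulUU mulr1; congr (mkmalgU _ 1).
  by apply/eqP; rewrite fmP fmM fmU.
have -> : forall w, c *: mkmalgU w 1 = mkmalgU w c :> freeX C.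
  by move=> w; rewrite -mul_malgC malgM_def fgmulUU mulr1 mul1m.
etransitivity; first exact: mmapU.
have rwordE w : rho_word C (FMonom [seq i.-1 | i <- w]) = rword w.
  by rewrite /rho_word; elim: w => //= i w ->.
exact: (congr1 (fun f : {scalar FdB C} => c * f (U m)) (rwordE _)).
Qed.

End ChenSolution.

(** * Uniqueness and multiplicativity of the flow *)

Section FlowTheory.
Variable R : realType.
Local Notation C := (R[i]).
Local Notation mu := (@lebesgue_measure R).
Local Notation nc := (@Normc.normc R).
Local Notation I_ T := (`[0, T]%classic : set R).
Local Notation U m := (mkmalgU m 1 : FdB C).
Variables (T : R) (a : nat -> R -> C).
Hypothesis T0 : 0 < T.

Lemma chen_flow_solution : in_X T a -> FdB_solution T a (chen_flow a).
Proof.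
move=> aX; have [M M1 aM] := in_X_bound aX.
have reg w := iint_regular T0 M1 aX.1 aM (w := w).
have pos m w : w \in comps (wdeg m) -> all (fun i => 0 < i)%N w.
  by rewrite mem_comps => /andP[].
split.
- apply: scalar_ext => m; rewrite chen_flowU counitlU.
  under eq_bigr do rewrite iint0.
  case E: (wdeg m) => [|n].
    rewrite /comps /= big_seq1 eqxx mul1r (wdeg_eq0 E) eqxx.
    by apply: (etrans (counitlU _ _)); rewrite eqxx.
  rewrite big_seq big1; first by case: eqP E => // ->; rewrite wdeg1.
  move=> w; rewrite mem_comps; case: w => [|i w]; first by rewrite andbC.
  by rewrite mul0r.
- move=> p; rewrite (_ : (fun x => _) = fun x =>
      \sum_(m <- msupp p) mcoeff m p * chen_flow a x (U m)); last first.
    by apply/funext => x; exact: scalarE.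
  apply: clipschitz_sum => m _; apply: clipschitzZ; first exact: ltW.
  rewrite (_ : (fun x => _) = fun x =>
      \sum_(w <- comps (wdeg m)) rword R w (U m) * iint a w x); last first.
    apply/funext => x; apply: (etrans (chen_flowU a x m)).
    by apply: eq_bigr => w _; rewrite mulrC.
  apply: clipschitz_sum => w wm.
  apply: clipschitzZ; first exact: ltW.
  by case: (reg w (pos _ _ wm)).
- apply: ae_interior.
  (* A single null set has to serve every p; this is possible because there are countably many
     words. *)
  have : {ae mu, forall x, forall w : seq nat, 0 < x < T -> all (fun i => 0 < i)%N w ->
      cderiv (iint a w) x (diint a w x)}.
    apply: ae_countable => w; have [aw|naw] := boolP (all (fun i => 0 < i)%N w).
      by apply: ae_imp (reg w aw).2 => x h x0T _; exact: h.
    by apply: ae_imp aM.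
  apply: ae_imp => x h x0T p.
  rewrite (_ : (fun y => _) = fun y =>
      \sum_(m <- msupp p) mcoeff m p * chen_flow a y (U m)); last first.
    by apply/funext => y; exact: scalarE.
  apply: (cderiv_eq _ (esym (scalarE (conv (FdB_field a x) (chen_flow a x)) p))).
  apply: cderiv_sum => m _; apply: cderivZ.
  apply: (cderiv_eq _ (dchen_flowU a x m)).
  rewrite (_ : (fun y => _) = fun y =>
      \sum_(w <- comps (wdeg m)) rword R w (U m) * iint a w y); last first.
    apply/funext => y; apply: (etrans (chen_flowU a y m)).
    by apply: eq_bigr => w _; rewrite mulrC.
  apply: cderiv_sum => w wm.
  rewrite [X in cderiv _ _ X]mulrC; apply: cderivZ.
  exact: h (pos _ _ wm).
Qed.

Lemma FdB_field1 x : FdB_field a x (U mone) = 0.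
Proof.
rewrite FdB_fieldU wdeg1; case: eqP => [/(congr1 (@wdeg))|_]; last by rewrite mulr0.
by rewrite wdeg1 wdegU.
Qed.

Lemma FdB_solution_ae H m : FdB_solution T a H ->
  {ae mu, forall x, 0 < x < T ->
    cderiv (fun y => H y (U m)) x (conv (FdB_field a x) (H x) (U m))}.
Proof.
move=> [_ _]; apply: ae_imp => x h /andP[x0 xT]; apply: h.
by rewrite /= in_itv /= !ltW.
Qed.

Lemma FdB_solution_unique H1 H2 : FdB_solution T a H1 -> FdB_solution T a H2 ->
  forall x, I_ T x -> H1 x =1 H2 x.
Proof.
move=> s1 s2; suff eqU n m : (wdeg m < n)%N -> forall x, I_ T x -> H1 x (U m) = H2 x (U m).
  by move=> x Ix; apply: scalar_ext => m; exact: (eqU (wdeg m).+1).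
elim: n m => // n IH m mn x Ix; apply/eqP; rewrite -subr_eq0; apply/eqP.
pose v y := H1 y (U m) - H2 y (U m).
have [z1 l1 _] := s1; have [z2 l2 _] := s2.
have -> : H1 x (U m) - H2 x (U m) = v x by [].
have lv : clipschitz (I_ T) v by apply: clipschitzB; [exact: ltW|exact: l1|exact: l2].
rewrite (clipschitz_constant lv) //; first by rewrite /v z1 z2 subrr.
apply: ae_imp2 (FdB_solution_ae m s1) (FdB_solution_ae m s2) => y h1 h2 y0T.
apply: cderiv_eq (cderivB (h1 y0T) (h2 y0T)) _.
apply/eqP; rewrite subr_eq0; apply/eqP; apply: conv_eq; first exact: FdB_field1.
move=> q qm; apply: IH; first by rewrite (leq_trans qm).
by case/andP: y0T => y0 yT; rewrite /= in_itv /= !ltW.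
Qed.

Lemma FdB_solution_one H : FdB_solution T a H ->
  forall x, I_ T x -> H x (U mone) = 1.
Proof.
move=> s x Ix; have [z l _] := s; rewrite (clipschitz_constant (l (U mone)) _ Ix).
  by rewrite z counitlU eqxx.
apply: ae_imp (FdB_solution_ae mone s) => y h y0T.
apply: cderiv_eq (h y0T) _; apply: conv1; exact: FdB_field1.
Qed.

(** The defect [H (p q) - H p * H q] vanishes at 0, and its derivative vanishes by the product rule
    and [conv_derivation], whose hypothesis in lower degree is the induction hypothesis. *)
Lemma FdB_solution_character H : FdB_solution T a H ->
  forall x, I_ T x -> is_character (H x).
Proof.
move=> s; suff mulU n p q : (wdeg p + wdeg q < n)%N -> forall x, I_ T x ->
    H x (U (mmul p q)) = H x (U p) * H x (U q).
  move=> x Ix; apply: character_ext; first exact: FdB_solution_one.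
  by move=> p q; exact: (mulU (wdeg p + wdeg q).+1).
elim: n p q => // n IH p q pqn x Ix; apply/eqP; rewrite -subr_eq0; apply/eqP.
pose v y := H y (U (mmul p q)) - H y (U p) * H y (U q).
have -> : H x (U (mmul p q)) - H x (U p) * H x (U q) = v x by [].
have [z l _] := s; have T0' := ltW T0.
have lv : clipschitz (I_ T) v.
  by apply: clipschitzB => //; apply: clipschitzM.
rewrite (clipschitz_constant lv) //.
  have zU m : H 0 (U m) = (m == mone)%:R := etrans (z (U m)) (counitlU C m).
  have -> : v 0 = (mmul p q == mone)%:R - (p == mone)%:R * (q == mone)%:R.
    by congr (_ - _ * _); exact: zU.
  by rewrite -natrM mulnb (cmM_eq1 p q) subrr.
have hpq := FdB_solution_ae (mmul p q) s.
apply: ae_imp2 hpq (ae_imp2 (fun x h1 h2 => conj h1 h2)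
  (FdB_solution_ae p s) (FdB_solution_ae q s)) => y h [h1 h2] y0T.
apply: cderiv_eq (cderivB (h y0T) (cderivM (h1 y0T) (h2 y0T))) _.
apply/eqP; rewrite subr_eq0; apply/eqP; apply: conv_derivation.
  exact: (primitive_derivation (c := fun i => a i y) (FdB_fieldU a y)).
move=> p' q' h'; apply: IH; first by rewrite (leq_trans h').
by case/andP: y0T => y0 yT; rewrite /= in_itv /= !ltW.
Qed.

Lemma FdB_flow_solution : in_X T a -> FdB_solution T a (FdB_flow T a).
Proof.
move=> aX; apply: (@xgetPex {classic (R -> {scalar FdB C})} _
  [set H | FdB_solution T a H]).
by exists (chen_flow a); exact: chen_flow_solution.
Qed.

Lemma FdB_flow_chen : in_X T a -> FdB_flow T a T =1 rho (chen T a).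
Proof.
move=> aX p; have IT : I_ T T by rewrite /= in_itv /= lexx ltW.
rewrite (FdB_solution_unique (FdB_flow_solution aX) (chen_flow_solution aX) IT).
apply: scalar_ext => m; exact/esym/rho_chenU.
Qed.

Lemma FdB_solution_t H : FdB_solution T a H ->
  {ae mu, forall x, 0 < x < T -> forall i, (0 < i)%N ->
    cderiv (fun y => H y (t_ C i)) x (\sum_(1 <= j < i.+1)
      a j x * ((\sum_(k < i.+1) H x (t_ C k) *: 'X^(k.+1)) ^+ j.+1)`_i.+1)}.
Proof.
move=> s; have [_ _] := s; apply: ae_imp => x h x0T i i0.
have Ix : I_ T x by case/andP: x0T => x0 xT; rewrite /= in_itv /= !ltW.
have [H1 HM] := FdB_solution_character s Ix.
apply: cderiv_eq (h Ix (t_ C i)) _.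
exact: (conv_character_t (c := fun i => a i x) i0 (FdB_fieldU a x) H1 HM).
Qed.

End FlowTheory.

(** * The Abel equation *)

Section Majorants.
Variable R : realType.
Local Notation C := (R[i]).
Local Notation nc := (@Normc.normc R).
Implicit Types (p : {poly C}) (q : {poly R}).

Definition nnegp q := forall i, 0 <= q`_i.

Lemma nnegpX : nnegp 'X.
Proof. by move=> i; rewrite coefX ler0n. Qed.

Lemma nnegpD q q' : nnegp q -> nnegp q' -> nnegp (q + q').
Proof. by move=> h h' i; rewrite coefD addr_ge0. Qed.

Lemma nnegpZ (x : R) q : 0 <= x -> nnegp q -> nnegp (x *: q).
Proof. by move=> x0 h i; rewrite coefZ mulr_ge0. Qed.

Lemma nnegpM q q' : nnegp q -> nnegp q' -> nnegp (q * q').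
Proof. by move=> h h' i; rewrite coefM sumr_ge0 // => j _; rewrite mulr_ge0. Qed.

Lemma nnegpXn q n : nnegp q -> nnegp (q ^+ n).
Proof.
move=> h; elim: n => [|n IH]; last by rewrite exprS; exact: nnegpM.
by move=> i; rewrite coef1 ler0n.
Qed.

Lemma nnegp_sum (I : Type) (r : seq I) (P : pred I) (F : I -> {poly R}) :
  (forall i, P i -> nnegp (F i)) -> nnegp (\sum_(i <- r | P i) F i).
Proof.
move=> h; apply: big_ind => //; last exact: nnegpD.
by move=> i; rewrite coef0.
Qed.

Lemma nnegp_partial q (x : R) n : nnegp q -> 0 <= x ->
  \sum_(0 <= i < n) q`_i * x ^+ i <= q.[x].
Proof.
move=> h x0; rewrite (horner_coef_wide _ (leq_maxr n (size q))).
rewrite -(big_mkord xpredT (fun i => q`_i * x ^+ i)).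
rewrite [leRHS](big_cat_nat _ (n := n)) ?leq_maxl //= lerDl.
by apply: sumr_ge0 => i _; rewrite mulr_ge0 // exprn_ge0.
Qed.

Lemma nnegp_coef_le q (x : R) i : nnegp q -> 0 <= x -> q`_i * x ^+ i <= q.[x].
Proof.
move=> h x0; rewrite (le_trans _ (nnegp_partial i.+1 h x0)) // big_nat_recr //= lerDr.
by apply: sumr_ge0 => j _; rewrite mulr_ge0 // exprn_ge0.
Qed.

(** Restricted to degrees below d because the bound in degree d is the one to be deduced. *)
Definition dominated (d : nat) p q := forall e, (e < d)%N -> nc p`_e <= q`_e.

Lemma dominatedM d p q p' q' :
  dominated d p q -> dominated d p' q' -> dominated d (p * p') (q * q').
Proof.
move=> h h' e ed; rewrite !coefM (le_trans (normc_sum _ _ _)) //.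
apply: ler_sum => i _; rewrite Normc.normcM ler_pM ?normc_ge0 //.
  by apply: h; rewrite (leq_ltn_trans _ ed) // -ltnS.
by apply: h'; rewrite (leq_ltn_trans _ ed) // leq_subr.
Qed.

Lemma dominatedX d p q n : dominated d p q -> dominated d (p ^+ n) (q ^+ n).
Proof.
move=> h; elim: n => [|n IH]; last by rewrite !exprS; exact: dominatedM.
by move=> e _; rewrite !coef1; case: eqP => _; rewrite ?Normc.normc1 ?normc0E.
Qed.

(* As p has no constant term, the coefficient of degree d of p ^+ j.+2 only involves
   the coefficients of p of degree less than d. *)
Lemma dominated_coef_exp d p q j : p`_0 = 0 -> nnegp q -> dominated d p q ->
  nc (p ^+ j.+2)`_d <= (q ^+ j.+2)`_d.
Proof.
move=> p0 hq h.
have pj0 : (p ^+ j.+1)`_0 = 0 by rewrite exprS coef0M p0 mul0r.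
rewrite exprS [in leRHS]exprS !coefM (le_trans (normc_sum _ _ _)) //.
apply: ler_sum => i _.
have qi : 0 <= q`_i * (q ^+ j.+1)`_(d - i) by rewrite mulr_ge0 //; exact: nnegpXn.
have [i0|i0] := posnP i; first by move: qi; rewrite i0 p0 mul0r normc0E.
have [id|] := eqVneq (i : nat) d; first by move: qi; rewrite id subnn pj0 mulr0 normc0E.
move=> idN; have id : (i < d)%N by rewrite ltn_neqAle idN -ltnS ltn_ord.
rewrite Normc.normcM ler_pM ?normc_ge0 //; first exact: h.
have := dominatedX j.+1 h; apply.
by rewrite ltn_subrL i0 (leq_ltn_trans _ id).
Qed.

Lemma coef_exp_eq (K : nzRingType) d (p p' : {poly K}) n :
  (forall e, (e < d)%N -> p`_e = p'`_e) -> forall e, (e < d)%N -> (p ^+ n)`_e = (p' ^+ n)`_e.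
Proof.
move=> h; elim: n => [|n IH] e ed; first by rewrite !expr0.
rewrite !exprS !coefM; apply: eq_bigr => i _; rewrite h ?IH //.
  by rewrite (leq_ltn_trans (leq_subr _ _)).
by rewrite (leq_ltn_trans _ ed) // -ltnS.
Qed.

Lemma coef_exp_lt (K : nzRingType) (p : {poly K}) n d : p`_0 = 0 -> (d < n)%N ->
  (p ^+ n)`_d = 0.
Proof.
move=> p0; elim: n d => // n IH d dn; rewrite exprS coefM big1 // => i _.
have [->|i0] := posnP i; first by rewrite p0 mul0r.
rewrite IH ?mulr0 //; rewrite -ltnS (leq_trans _ dn) // ltnS -subn_gt0.
by rewrite subKn // -ltnS.
Qed.

Lemma geometric_sum_le (x : R) n : 0 <= x -> x <= 2^-1 ->
  \sum_(1 <= j < n.+1) x ^+ j <= 2 * x.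
Proof.
(* Adding a bound on the tail makes the induction go through. *)
move=> x0 x2; suff : \sum_(1 <= j < n.+1) x ^+ j + 2 * x ^+ n.+1 <= 2 * x.
  by apply: le_trans; rewrite lerDl mulr_ge0 // exprn_ge0.
elim: n => [|n IH]; first by rewrite big_geq // add0r expr1.
rewrite big_nat_recr //=; apply: le_trans IH; rewrite -addrA lerD2l.
rewrite [x ^+ n.+2]exprS mulrA; have := exprn_ge0 n.+1 x0; move: (x ^+ _) => y y0.
have : 2 * x * y <= 1 * y by rewrite ler_wpM2r //; lra.
lra.
Qed.

Lemma power_sum_le (M s : R) n : 0 <= M -> 0 <= s -> M * s <= 2^-1 ->
  \sum_(1 <= j < n.+1) M ^+ j * s ^+ j.+1 <= 2 * M * s ^+ 2.
Proof.
move=> M0 s0 h.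
have -> : \sum_(1 <= j < n.+1) M ^+ j * s ^+ j.+1 = (\sum_(1 <= j < n.+1) (M * s) ^+ j) * s.
  by rewrite mulr_suml; apply: eq_bigr => j _; rewrite exprSr mulrA exprMn.
rewrite expr2 mulrA ler_wpM2r // -mulrA; apply: geometric_sum_le => //.
exact: mulr_ge0.
Qed.

End Majorants.

(** * The majorant and its radius *)

Section PicardMajorant.
Variable R : realType.
Variables (T M : R).
Hypotheses (T0 : 0 < T) (M1 : 1 <= M).

(** The sum is cut at j = m + 1 to stay polynomial. As [maj] has no constant term, the omitted
    powers only affect degrees above m + 2, beyond those used to bound [c_k] for k <= m + 1. *)
Fixpoint maj (n : nat) : {poly R} :=
  if n is m.+1
  then 'X + T *: \sum_(1 <= j < m.+2) M ^+ j *: maj m ^+ j.+1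
  else 'X.

(** Two demands fix the constant. For values up to 2 rho the sum is at most 2 M (2 rho)^2 = rho / (2
    (1 + T)), so an iterate stays below 2 rho. For values up to 4 rho the Abel field must have
    Lipschitz constant at most 1, which follows from 8 M rho <= 1/2. *)
Definition radius : R := (16 * M * (1 + T))^-1.

Let M0 : 0 < M. Proof. by rewrite (lt_le_trans ltr01). Qed.
Let T1 : 0 < 1 + T. Proof. by rewrite addr_gt0. Qed.

Lemma radius_gt0 : 0 < radius.
Proof. by rewrite invr_gt0 !mulr_gt0. Qed.

Lemma radiusE : 16 * M * (1 + T) * radius = 1.
Proof. by rewrite mulfV // gt_eqF // !mulr_gt0. Qed.

Lemma radius_small : 16 * (M * radius) <= 1.
Proof.
have := radiusE; have := mulr_gt0 (mulr_gt0 M0 radius_gt0) T0; have := T0.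
move: radius => y h1 h2 h3; nra.
Qed.

Lemma maj_nneg n : nnegp (maj n).
Proof.
elim: n => [|n IH] /=; first exact: nnegpX.
apply: nnegpD; first exact: nnegpX.
apply: nnegpZ; first exact: ltW.
apply: nnegp_sum => j _; apply: nnegpZ; first by rewrite exprn_ge0 // ltW.
exact: nnegpXn.
Qed.

Lemma maj_sum_le m (x : R) : 0 <= x -> x <= 2 * radius ->
  \sum_(1 <= j < m.+1) M ^+ j * x ^+ j.+1 <= radius / (1 + T).
Proof.
move=> x0 xr; have r0 := ltW radius_gt0.
have Mr := radius_small.
have Mx : M * x <= 2^-1.
  have : M * x <= M * (2 * radius) by rewrite ler_wpM2l // ltW.
  move: Mr; rewrite mulrCA; move: (M * radius) => y; lra.
apply: (le_trans (power_sum_le m (ltW M0) x0 Mx)).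
have : x ^+ 2 <= (2 * radius) ^+ 2 by rewrite lerXn2r // nnegrE ?mulr_ge0.
move=> /(ler_wpM2l (_ : 0 <= 2 * M)) h; apply: (le_trans (h _)).
  by rewrite mulr_ge0 // ltW.
rewrite ler_pdivlMr // exprMn expr2.
have -> : 2 * M * (2 ^+ 2 * (radius * radius)) * (1 + T) =
  (16 * M * (1 + T) * radius) * radius / 2 by field.
rewrite radiusE mul1r; move: r0; move: radius => y; lra.
Qed.

Lemma maj_radius n : (maj n).[radius] <= 2 * radius.
Proof.
have r0 := ltW radius_gt0.
elim: n => [|n IH] /=; first by rewrite hornerX; lra.
rewrite hornerD hornerX hornerZ horner_sum.
under eq_bigr do rewrite hornerZ horner_exp.
have m0 : 0 <= (maj n).[radius].
  by have := nnegp_partial 0 (maj_nneg n) r0; rewrite big_geq.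
have h := ler_wpM2l (ltW T0) (maj_sum_le n.+1 m0 IH).
have : T * (radius / (1 + T)) <= radius.
  rewrite mulrCA ler_piMr // ler_pdivrMr //; lra.
lra.
Qed.

Lemma maj1_ge1 n : 1 <= (maj n)`_1.
Proof.
case: n => [|n] /=; first by rewrite coefX.
rewrite coefD coefX /= lerDl.
suff : nnegp (T *: \sum_(1 <= j < n.+2) M ^+ j *: maj n ^+ j.+1) by apply.
apply: nnegpZ; first exact: ltW.
apply: nnegp_sum => j _; apply: nnegpZ; first by rewrite exprn_ge0 // ltW.
exact/nnegpXn/maj_nneg.
Qed.

End PicardMajorant.

(** * Limits at a geometric rate *)

Section GeometricLimits.
Variable R : realType.
Local Notation C := (R[i]).
Local Notation nc := (@Normc.normc R).
Implicit Types (u : nat -> C) (l : C) (K : R).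

Lemma half_exp_small K e : 0 < e -> exists n, K * 2^-1 ^+ n <= e.
Proof.
move=> e0; pose n := Num.bound (`|K| / e); exists n.
have h : `|K| / e < n%:R by rewrite archi_boundP // divr_ge0 // ltW.
rewrite (le_trans (ler_wpM2r _ (ler_norm K))) ?exprn_ge0 //.
rewrite exprVn ler_pdivrMr ?exprn_gt0 // mulrC -ler_pdivrMr // (le_trans (ltW h)) //.
by rewrite -natrX ler_nat ltnW // ltn_expl.
Qed.

Lemma le_half_exp (x y K : R) : (forall n, x <= y + K * 2^-1 ^+ n) -> x <= y.
Proof.
move=> h; apply/ler_addgt0Pr => e e0; have [n Kn] := half_exp_small K e0.
by rewrite (le_trans (h n)) // lerD2l.
Qed.

Definition geo_cvg K u l := forall n, nc (l - u n) <= K * 2^-1 ^+ n.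

(** The intervals of centre [f n] and half-width 2 K 2^-n are nested, since the half-width drops by
    exactly K 2^-n at each step; the supremum of the left ends lies in all of them. *)
Lemma real_geo_limit (f : nat -> R) K :
  (forall n, `|f n.+1 - f n| <= K * 2^-1 ^+ n) ->
  exists x : R, forall n, `|x - f n| <= 2 * K * 2^-1 ^+ n.
Proof.
move=> h; pose lo n := f n - 2 * K * 2^-1 ^+ n; pose hi n := f n + 2 * K * 2^-1 ^+ n.
have K0 n : 0 <= K * 2^-1 ^+ n by rewrite (le_trans _ (h n)).
have loS n : lo n <= lo n.+1.
  have := h n; rewrite ler_norml => /andP[h1 _]; rewrite /lo exprS.
  by move: h1; rewrite -!mulrA (mulrCA K); move: (K * _) => z; lra.
have hiS n : hi n.+1 <= hi n.
  have := h n; rewrite ler_norml => /andP[_ h1]; rewrite /hi exprS.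
  by move: h1; rewrite -!mulrA (mulrCA K); move: (K * _) => z; lra.
have lohi m n : lo m <= hi n.
  apply: (@le_trans _ _ (lo (maxn m n))).
    have := leq_maxl m n; move: (maxn m n) => k /subnK <-.
    by elim: (k - m)%N => // d IH; rewrite (le_trans IH) // addSn.
  apply: (@le_trans _ _ (hi (maxn m n))).
    by rewrite /lo /hi; have := K0 (maxn m n); rewrite -!mulrA; move: (K * _) => z; lra.
  have := leq_maxr m n; move: (maxn m n) => k /subnK <-.
  by elim: (k - n)%N => // d IH; rewrite (le_trans _ IH) // addSn.
have sup_lo : has_sup (range lo).
  by split; [exists (lo 0%N), 0%N|exists (hi 0%N) => _ [n _ <-]].
exists (sup (range lo)) => n; rewrite ler_norml; apply/andP; split.
  have : lo n <= sup (range lo) by apply: sup_upper_bound => //; exists n.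
  by rewrite /lo; lra.
have : sup (range lo) <= hi n by apply: ge_sup; [exact: sup_lo.1|move=> _ [m _ <-]].
by rewrite /hi; lra.
Qed.

Lemma geo_limit u K : (forall n, nc (u n.+1 - u n) <= K * 2^-1 ^+ n) ->
  exists l, geo_cvg (4 * K) u l.
Proof.
move=> h.
have [lr hr] := @real_geo_limit (fun n => complex.Re (u n)) K (fun n => le_trans
  (eq_ind_r (fun z => `|z| <= _) (normc_Re (u n.+1 - u n)) (esym (ReB _ _))) (h n)).
have [li hi] := @real_geo_limit (fun n => complex.Im (u n)) K (fun n => le_trans
  (eq_ind_r (fun z => `|z| <= _) (normc_Im (u n.+1 - u n)) (esym (ImB _ _))) (h n)).
exists (Complex lr li) => n; rewrite (le_trans (normc_le_ReIm _)) // ReB ImB.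
apply: (le_trans (lerD (hr n) (hi n))).
by rewrite -mulrDl -mulrDl; lra.
Qed.

(** Summing the steps replaces the constant [K'], however bad, by one governed by the steps alone.
    Applied to differences of partial sums at two points, it yields a constant proportional to their
    distance. *)
Lemma geo_tail u K K' l : (forall n, nc (u n.+1 - u n) <= K * 2^-1 ^+ n) ->
  geo_cvg K' u l -> geo_cvg (2 * K) u l.
Proof.
move=> h hl n.
have K0 k : 0 <= K * 2^-1 ^+ k by rewrite (le_trans _ (h k)) // normc_ge0.
have fin d : nc (u (d + n)%N - u n) <= 2 * K * 2^-1 ^+ n - 2 * K * 2^-1 ^+ (d + n).
  elim: d => [|d IH]; first by rewrite !subrr normc0E.
  rewrite (le_trans (normc_dist _ _ (u (d + n)%N))) // (le_trans (lerD (h (d + n)%N) IH)) //.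
  rewrite addSn exprS -!mulrA (mulrCA K 2^-1).
  by move: (K * _) (K * _) => y z; lra.
apply: (@le_half_exp _ _ K') => d.
rewrite (le_trans (normc_dist _ _ (u (d + n)%N))) // addrC lerD //.
  rewrite (le_trans (fin d)) // lerBlDr lerDl -mulrA mulr_ge0 //.
rewrite (le_trans (hl _)) //; apply: ler_wpM2l.
  have := le_trans (normc_ge0 _) (hl 0%N); by rewrite expr0 mulr1.
by rewrite exprD ler_piMr ?exprn_ge0 // exprn_ile1 // invf_le1 // ler1n.
Qed.

Lemma geo_cvg_unique u K K' l l' : geo_cvg K u l -> geo_cvg K' u l' -> l = l'.
Proof.
move=> h h'; apply/eqP; rewrite -subr_eq0; apply/eqP/Normc.eq0_normc.
apply/eqP; rewrite eq_le normc_ge0 andbT; apply: (@le_half_exp _ _ (K + K')) => n.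
rewrite add0r (le_trans (normc_dist _ _ (u n))) // mulrDl lerD //.
by rewrite normcB_sym.
Qed.

Lemma geo_cvg_norm u K l B : geo_cvg K u l -> (forall n, nc (u n) <= B) -> nc l <= B.
Proof.
move=> h hB; apply: (@le_half_exp _ _ K) => n.
by rewrite -[l](subrK (u n)) (le_trans (normcD_le _ _)) // addrC lerD.
Qed.

Lemma geo_ccvg u K l : geo_cvg K u l -> ccvg u l.
Proof.
move=> h; have small e : 0 < e -> \forall n \near \oo, nc (l - u n) <= e.
  move=> e0; have [N KN] := half_exp_small K e0; exists N => // n /= Nn.
  rewrite (le_trans (h n)) // (le_trans _ KN) //; apply: ler_wpM2l.
    by have := le_trans (normc_ge0 _) (h 0%N); rewrite expr0 mulr1.
  by rewrite ler_wiXn2l // invf_le1 // ler1n.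
split; apply/cvgrPdist_le => e /small; apply: filterS => n.
  by apply: le_trans; rewrite -ReB normc_Re.
by apply: le_trans; rewrite -ImB normc_Im.
Qed.

Lemma ccvg_norm u l B : ccvg u l -> (forall n, nc (u n) <= B) -> nc l <= B.
Proof.
move=> [/cvgrPdist_le hr /cvgrPdist_le hi] hB; apply/ler_addgt0Pr => e e0.
have e20 : 0 < e / 2 by rewrite divr_gt0.
have [n [/= hrn hin]] := @filter_ex _ _ _ _ (filterI (hr _ e20) (hi _ e20)).
rewrite -[l](subrK (u n)) (le_trans (normcD_le _ _)) // addrC lerD //.
by rewrite (le_trans (normc_le_ReIm _)) // ReB ImB [leRHS]splitr lerD.
Qed.

Lemma ccvgB u u' l l' : ccvg u l -> ccvg u' l' -> ccvg (fun n => u n - u' n) (l - l').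
Proof.
move=> [h1 h2] [h1' h2']; split; rewrite (ReB, ImB).
  by under eq_fun do rewrite ReB; exact: cvgB.
by under eq_fun do rewrite ImB; exact: cvgB.
Qed.

End GeometricLimits.

Section LipschitzImprovement.
Variable R : realType.
Local Notation C := (R[i]).
Local Notation mu := (@lebesgue_measure R).
Local Notation nc := (@Normc.normc R).
Local Notation I_ T := (`[0, T]%classic : set R).

(** A solution comes with some unspecified Lipschitz constant for each coefficient; bounds uniform
    in the coefficient must come from the derivatives. *)
Lemma clipschitz_improve (T B : R) (v : R -> C) : 0 <= B -> clipschitz (I_ T) v ->
  {ae mu, forall x, 0 < x < T -> exists2 l, nc l <= B & cderiv v x l} ->
  forall x y, I_ T x -> I_ T y -> nc (v x - v y) <= B * `|x - y|.
Proof.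
move=> B0 /clipschitz_ge0[L L0 h] dv x y.
wlog yx : x y / y <= x.
  move=> g Ix Iy; have [/g|/ltW/g g'] := leP y x; first exact.
  by rewrite normcB_sym distrC; exact: g'.
rewrite /= !in_itv /= => /andP[x0 xT] /andP[y0 yT].
rewrite ger0_norm ?subr_ge0 //; apply: (lipschitz_growth yx L0 B0).
  move=> z w /andP[yz zx] /andP[yw wx]; apply: h; rewrite /= in_itv /=.
    by rewrite (le_trans y0 yz) (le_trans zx xT).
  by rewrite (le_trans y0 yw) (le_trans wx xT).
apply: ae_imp dv => z g /andP[yz zx]; apply: g.
by rewrite (le_lt_trans y0 yz) (lt_le_trans zx xT).
Qed.

Lemma normc_expB (s : R) (z w : C) j : nc z <= s -> nc w <= s ->
  nc (z ^+ j.+1 - w ^+ j.+1) <= j.+1%:R * s ^+ j * nc (z - w).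
Proof.
move=> zs ws; have s0 := le_trans (normc_ge0 _) zs.
elim: j => [|j IH]; first by rewrite !expr1 expr0 !mul1r.
have -> : z ^+ j.+2 - w ^+ j.+2 = z * (z ^+ j.+1 - w ^+ j.+1) + (z - w) * w ^+ j.+1.
  by rewrite [z ^+ j.+2]exprS [w ^+ j.+2]exprS; ring.
rewrite (le_trans (normcD_le _ _)) // !Normc.normcM normcX.
have h1 : nc z * nc (z ^+ j.+1 - w ^+ j.+1) <= s * (j.+1%:R * s ^+ j * nc (z - w)).
  by rewrite ler_pM ?normc_ge0.
have h2 : nc (z - w) * nc w ^+ j.+1 <= nc (z - w) * s ^+ j.+1.
  by rewrite ler_wpM2l ?normc_ge0 // lerXn2r // nnegrE normc_ge0.
rewrite (le_trans (lerD h1 h2)) // [j.+2%:R]mulrSr exprS.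
by rewrite le_eqVlt; apply/orP; left; apply/eqP; ring.
Qed.

(** At half the radius each term of degree d gains a factor 2^-d over the majorant at [rho]. *)
Lemma horner_tail (p : {poly C}) (q : {poly R}) (rho : R) (r : C) N :
  (forall d, nc p`_d <= q`_d) -> nnegp q -> 0 <= rho -> nc r <= rho / 2 ->
  nc (p.[r] - \sum_(0 <= d < N) p`_d * r ^+ d) <= 2^-1 ^+ N * q.[rho].
Proof.
move=> pq q0 rho0 rr; pose D := maxn N (size p).
have ND : (N <= D)%N by exact: leq_maxl.
rewrite (horner_coef_wide _ (leq_maxr N (size p))).
rewrite -(big_mkord xpredT (fun d => p`_d * r ^+ d)) (big_cat_nat _ (n := N)) //=.
rewrite [X in nc X]addrAC subrr add0r (le_trans (normc_sum _ _ _)) //.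
have := nnegp_partial D q0 rho0; rewrite (big_cat_nat _ (n := N)) //=.
set X := \sum_(0 <= i < N) _; set Y := \sum_(N <= i < D) _ => XY.
have X0 : 0 <= X by apply: sumr_ge0 => i _; rewrite mulr_ge0 // exprn_ge0.
apply: (@le_trans _ _ (2^-1 ^+ N * Y)); last first.
  by rewrite ler_wpM2l ?exprn_ge0 // (le_trans _ XY) // lerDr.
rewrite /Y mulr_sumr; apply: ler_sum_nat => i /andP[Ni _].
rewrite Normc.normcM normcX mulrCA ler_pM ?normc_ge0 ?exprn_ge0 ?normc_ge0 //.
rewrite (le_trans (lerXn2r i _ _ rr)) ?nnegrE ?normc_ge0 ?divr_ge0 //.
rewrite exprMn mulrC ler_wpM2r ?exprn_ge0 //.
by rewrite ler_wiXn2l // invf_le1 // ler1n.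
Qed.

End LipschitzImprovement.

(** * Uniqueness for the Abel equation *)

Section AbelEquation.
Variable R : realType.
Local Notation C := (R[i]).
Local Notation mu := (@lebesgue_measure R).
Local Notation nc := (@Normc.normc R).
Local Notation I_ T := (`[0, T]%classic : set R).
Variables (T M : R) (a c : nat -> R -> C).
Hypotheses (T0 : 0 < T) (M1 : 1 <= M).
Hypothesis aM : {ae mu, forall x, I_ T x -> forall i, (0 < i)%N -> nc (a i x) <= M ^+ i}.
Local Notation rho := (radius T M).

Let M0 : 0 <= M. Proof. by rewrite (le_trans ler01). Qed.
Let rho0 : 0 < rho. Proof. exact: radius_gt0. Qed.

(** From i + 1 <= 2^i, the i-th term has Lipschitz constant at most (8 M rho)^i, and these add up to
    at most 16 M rho <= 1. *)
Lemma abel_field_lipschitz x (z w : C) n :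
  (forall i, (0 < i)%N -> nc (a i x) <= M ^+ i) -> nc z <= 4 * rho -> nc w <= 4 * rho ->
  nc (\sum_(1 <= i < n) a i x * z ^+ i.+1 - \sum_(1 <= i < n) a i x * w ^+ i.+1)
    <= nc (z - w).
Proof.
move=> ax zs ws; have r0 := ltW rho0.
case: n => [|n]; first by rewrite !big_geq // subrr normc0E normc_ge0.
rewrite -sumrB (le_trans (normc_sum _ _ _)) //.
apply: (@le_trans _ _ (\sum_(1 <= i < n.+1) (2 * (M * (4 * rho))) ^+ i * nc (z - w))).
  apply: ler_sum_nat => i /andP[i0 _].
  rewrite -mulrBr Normc.normcM.
  apply: (@le_trans _ _ (M ^+ i * (i.+1%:R * (4 * rho) ^+ i * nc (z - w)))).
    by rewrite ler_pM ?normc_ge0 ?ax ?normc_expB.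
  have s0 : 0 <= 4 * rho by rewrite mulr_ge0.
  move: (4 * rho) s0 => s s0; rewrite (exprMn i 2) (exprMn i M) mulrCA -!mulrA.
  rewrite ler_wpM2l ?exprn_ge0 // ler_wpM2r ?mulr_ge0 ?exprn_ge0 ?normc_ge0 //.
  by rewrite -natrX ler_nat ltn_expl.
rewrite -mulr_suml ler_piMl ?normc_ge0 //.
have h := radius_small T0 M1.
apply: (le_trans (geometric_sum_le _ _ _)).
- by rewrite !mulr_ge0.
- by move: h; rewrite (mulrCA M); move: (M * _) => y; lra.
- by move: h; rewrite (mulrCA M); move: (M * _) => y; lra.
Qed.

(** Only v is known to be small. Wherever u and v agree, u is at most 2 rho, and its own Lipschitz
    constant keeps it below 4 rho for a short time; there the field estimate applies, and agreement
    propagates. *)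
Lemma abel_unique (r : C) (u v : R -> C) :
  abel_solution T a r u -> abel_solution T a r v ->
  (forall x, I_ T x -> nc (v x) <= 2 * rho) ->
  forall x, I_ T x -> u x = v x.
Proof.
move=> [u0 /clipschitz_ge0[Lu Lu0 lu] du] [v0 /clipschitz_ge0[Lv Lv0 lv] dv] vB.
have II x : I_ T x = (0 <= x <= T) by rewrite /= in_itv.
pose w x := u x - v x.
have lw x y : I_ T x -> I_ T y -> nc (w x - w y) <= (Lu + Lv) * `|x - y|.
  move=> Ix Iy; have -> : w x - w y = (u x - u y) - (v x - v y) by rewrite /w; ring.
  by rewrite (le_trans (normcB_le _ _)) // mulrDl lerD ?lu ?lv.
suff w0 x : 0 <= x <= T -> w x = 0.
  by move=> x; rewrite II => /w0 /eqP; rewrite subr_eq0 => /eqP.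
have L0 : 0 <= Lu + Lv by rewrite addr_ge0.
move: x; apply: interval_induction => x.
  move=> /andP[x0 xT] h; have [->|xN0] := eqVneq x 0; first by rewrite /w u0 v0 subrr.
  have {}x0 : 0 < x by rewrite lt_neqAle eq_sym xN0.
  apply/Normc.eq0_normc/eqP; rewrite eq_le normc_ge0 andbT.
  apply: (@le_half_exp _ _ _ ((Lu + Lv) * x)) => n; rewrite add0r.
  pose y := x - x * 2^-1 ^+ n.
  have h1 : 2^-1 ^+ n <= 1 :> R by rewrite exprn_ile1 // invf_le1 // ler1n.
  have h2 : 0 < 2^-1 ^+ n :> R by rewrite exprn_gt0.
  have y0 : 0 <= y by rewrite subr_ge0 ler_piMr // ltW.
  have yx : y < x by rewrite gtrBl mulr_gt0.
  have := lw x y; rewrite !II (h y) ?y0 //= (ltW x0) xT (le_trans (ltW yx)) // subr0.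
  by move=> /(_ isT isT); rewrite /y subKr gtr0_norm ?mulr_gt0 // mulrA.
move=> /andP[x0 xT] h; have wx : w x = 0 by apply: h; rewrite x0 lexx.
(* The second bound keeps u within 4 rho; the first makes each integration of the estimate halve the
   bound on u - v, starting from 8 rho. *)
pose e := Num.min (2^-1) (2 * rho / (Lu + 1)).
have Lu1 : 0 < Lu + 1 by rewrite ltr_wpDl.
have e0 : 0 < e by rewrite lt_min invr_gt0 ltr0n divr_gt0 // mulr_gt0.
exists e => // y /andP[xy ye] yT.
have Ix : I_ T x by rewrite II x0 ltW.
have Isub z : x <= z <= y -> I_ T z.
  by move=> /andP[xz zy]; rewrite II (le_trans x0 xz) (le_trans zy yT).
have zxe z : x <= z <= y -> `|z - x| <= e.
  move=> /andP[xz zy]; rewrite ger0_norm ?subr_ge0 // lerBlDl.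
  by rewrite (le_trans zy) // ltW.
have ub z : x <= z <= y -> nc (u z) <= 4 * rho.
  move=> xzy; have xz := zxe _ xzy; rewrite -[u z](subrK (u x)) (le_trans (normcD_le _ _)) //.
  have ux : nc (u x) <= 2 * rho.
    by have /eqP := wx; rewrite subr_eq0 => /eqP ->; exact: vB.
  have h1 : nc (u z - u x) <= Lu * (2 * rho / (Lu + 1)).
    rewrite (le_trans (lu _ _ (Isub _ xzy) Ix)) // ler_wpM2l // (le_trans xz) //.
    by rewrite ge_min lexx orbT.
  have h2 : Lu * (2 * rho / (Lu + 1)) <= 2 * rho.
    by rewrite mulrCA ler_piMr ?mulr_ge0 ?(ltW rho0) // ler_pdivrMr // mul1r lerDl.
  by move: (le_trans h1 h2) ux; lra.
have vb z : x <= z <= y -> nc (v z) <= 4 * rho.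
  move=> /Isub/vB h1; rewrite (le_trans h1) // ler_wpM2r ?(ltW rho0) // ler_nat //.
have K0 : 0 <= 8 * rho by rewrite mulr_ge0 // ltW.
have key n z : x <= z <= y -> nc (w z) <= 8 * rho * 2^-1 ^+ n.
  elim: n z => [|n IH] z xzy.
    rewrite expr0 mulr1 (le_trans (normcB_le _ _)) //.
    rewrite (le_trans (lerD (ub _ xzy) (vb _ xzy))) // -mulrDl.
    by rewrite ler_wpM2r ?(ltW rho0) // -natrD ler_nat.
  have /andP[xz zy] := xzy.
  have B0 : 0 <= 8 * rho * 2^-1 ^+ n by rewrite mulr_ge0 ?exprn_ge0.
  have h1 : nc (w z - w x) <= 8 * rho * 2^-1 ^+ n * (z - x).
    apply: (lipschitz_growth xz L0 B0).
      move=> s t /andP[xs sz] /andP[xt tz]; apply: lw; apply: Isub.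
        by rewrite xs (le_trans sz zy).
      by rewrite xt (le_trans tz zy).
    apply: ae_imp2 aM (ae_imp2 (fun x h1 h2 => conj h1 h2) du dv) => t at_ [dut dvt] /andP[xt tz].
    have xty : x <= t <= y by rewrite (ltW xt) (le_trans (ltW tz) zy).
    have It := Isub _ xty.
    have [l cl dl] := dut It; have [l' cl' dl'] := dvt It.
    exists (l - l'); last exact: cderivB.
    apply: (ccvg_norm (ccvgB cl cl')) => k.
    rewrite (le_trans (abel_field_lipschitz _ (at_ It) (ub _ xty) (vb _ xty))) //.
    exact: IH.
  rewrite wx subr0 in h1; rewrite (le_trans h1) // exprSr mulrA ler_wpM2l //.
  have := zxe _ xzy; rewrite ger0_norm ?subr_ge0 // => h2; rewrite (le_trans h2) //.
  by rewrite ge_min lexx.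
apply/Normc.eq0_normc/eqP; rewrite eq_le normc_ge0 andbT.
by apply: (@le_half_exp _ _ _ (8 * rho)) => n; rewrite add0r key // ltW //= lexx.
Qed.

End AbelEquation.

(** * The series solution and its convergence *)

Section SeriesSolution.
Variable R : realType.
Local Notation C := (R[i]).
Local Notation mu := (@lebesgue_measure R).
Local Notation nc := (@Normc.normc R).
Local Notation I_ T := (`[0, T]%classic : set R).
Variables (T M : R) (a c : nat -> R -> C).
Hypotheses (T0 : 0 < T) (M1 : 1 <= M).
Local Notation rho := (radius T M).
Local Notation maj := (maj T M).

Definition Vpoly (n : nat) (x : R) : {poly C} := \sum_(k < n.+1) c k x *: 'X^(k.+1).

Definition dcoef (i : nat) (x : R) : C :=
  \sum_(1 <= j < i.+1) a j x * (Vpoly i x ^+ j.+1)`_i.+1.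

Hypothesis aM : {ae mu, forall x, I_ T x -> forall i, (0 < i)%N -> nc (a i x) <= M ^+ i}.
Hypothesis c0 : forall x, I_ T x -> c 0 x = 1.
Hypothesis cl : forall i, clipschitz (I_ T) (c i).
Hypothesis ci : forall i, (0 < i)%N -> c i 0 = 0.
Hypothesis dc : {ae mu, forall x, 0 < x < T -> forall i, (0 < i)%N ->
  cderiv (c i) x (dcoef i x)}.

Let M0 : 0 <= M. Proof. by rewrite (le_trans ler01). Qed.
Let rho0 : 0 < rho. Proof. exact: radius_gt0. Qed.
Let II x : I_ T x = (0 <= x <= T). Proof. by rewrite /= in_itv. Qed.
Let Iin x : 0 < x < T -> I_ T x.
Proof. by rewrite II => /andP[x0 xT]; rewrite !ltW. Qed.

Lemma coef_Vpoly n x e :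
  (Vpoly n x)`_e = if (0 < e <= n.+1)%N then c e.-1 x else 0.
Proof.
rewrite coef_sum; case: e => [|e] /=.
  by apply: big1 => k _; rewrite coefZ coefXn mulr0.
have [en|en] := leqP e.+1 n.+1; last first.
  apply: big1 => k _; rewrite coefZ coefXn eqSS; case: eqP => [ek|_]; last by rewrite mulr0.
  by move: en; rewrite ek ltnS ltnNge -ltnS ltn_ord.
rewrite (bigD1 (Ordinal en)) //= coefZ coefXn eqxx mulr1 big1 ?addr0 // => k ke.
rewrite coefZ coefXn eqSS; case: eqP => [ek|_]; last by rewrite mulr0.
by case/eqP: ke; apply: val_inj.
Qed.

Lemma horner_Vpoly n x r : (Vpoly n x).[r] = \sum_(k < n.+1) c k x * r ^+ k.+1.
Proof.
by rewrite horner_sum; apply: eq_bigr => k _; rewrite hornerZ hornerXn.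
Qed.

(** For k > 0, T times this number is the coefficient of degree k + 1 in [maj n.+1]. *)
Definition dbound (n k : nat) : R :=
  \sum_(1 <= j < n.+2) M ^+ j * (maj n ^+ j.+1)`_k.+1.

Let majX n j d : 0 <= (maj n ^+ j)`_d.
Proof. exact/nnegpXn/maj_nneg. Qed.

Lemma dbound_ge0 n k : 0 <= dbound n k.
Proof. by apply: sumr_ge0 => j _; rewrite mulr_ge0 ?exprn_ge0. Qed.

Lemma dcoef_le n k x : (k <= n.+1)%N ->
  (forall i, (0 < i)%N -> nc (a i x) <= M ^+ i) ->
  (forall i, (i < k)%N -> nc (c i x) <= (maj n)`_i.+1) ->
  nc (dcoef k x) <= dbound n k.
Proof.
move=> kn ax cx; rewrite (le_trans (normc_sum _ _ _)) //.
apply: (@le_trans _ _ (\sum_(1 <= j < k.+1) M ^+ j * (maj n ^+ j.+1)`_k.+1)).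
  apply: ler_sum_nat => -[//|j] _; rewrite Normc.normcM ler_pM ?normc_ge0 ?ax //.
  apply: dominated_coef_exp; first by rewrite coef_Vpoly.
    exact: maj_nneg.
  move=> e ek; rewrite coef_Vpoly; case: ifP => [/andP[e0 _]|_]; last first.
    by rewrite normc0E; have := maj_nneg T0 M1 n; apply.
  by case: e e0 ek => // e _ ek; exact: cx.
rewrite /dbound [leRHS](big_cat_nat _ (n := k.+1)) //= lerDl.
by apply: sumr_ge0 => j _; rewrite mulr_ge0 ?exprn_ge0.
Qed.

(** For k > 0, [c k] starts at 0 and its derivative is at most [dbound], so over a time at most T it
    stays below the coefficient of the next iterate. The coefficient of degree 1 takes care of
    [c 0 = 1]. *)
Lemma coef_le_maj n k x : (k <= n)%N -> I_ T x -> nc (c k x) <= (maj n)`_k.+1.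
Proof.
elim: n k x => [|n IH] k x kn Ix.
  by move: kn; rewrite leqn0 => /eqP ->; rewrite c0 // Normc.normc1 maj1_ge1.
have [->|k0] := posnP k; first by rewrite c0 // Normc.normc1 maj1_ge1.
have I0 : I_ T 0 by rewrite II lexx ltW.
have dk : {ae mu, forall x, 0 < x < T -> exists2 l, nc l <= dbound n k & cderiv (c k) x l}.
  apply: ae_imp2 aM dc => y ay dy y0T; exists (dcoef k y); last exact: dy.
  apply: dcoef_le => //; first exact: ay (Iin y0T).
  by move=> i ik; apply: IH (Iin y0T); rewrite -ltnS (leq_trans ik).
have := clipschitz_improve (dbound_ge0 n k) (cl k) dk Ix I0.
rewrite ci // !subr0 => h; rewrite (le_trans h) //=.
rewrite coefD coefX eqSS [k == 0%N]gtn_eqF // add0r coefZ coef_sum mulrC.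
move: Ix; rewrite II => /andP[x0 xT]; rewrite ger0_norm // ler_pM ?dbound_ge0 //.
rewrite /dbound le_eqVlt; apply/orP; left; apply/eqP; apply: eq_bigr => j _.
by rewrite coefZ.
Qed.

(** A Cauchy estimate: a term of a nonnegative polynomial is at most its value at [rho], here 2
    rho. *)
Lemma coef_geometric k x : I_ T x -> nc (c k x) * rho ^+ k <= 2.
Proof.
move=> Ix; have r0 := ltW rho0.
have := nnegp_coef_le k.+1 (maj_nneg T0 M1 k) r0.
have := ler_wpM2r (exprn_ge0 k.+1 r0) (coef_le_maj (leqnn k) Ix).
move=> /le_trans h /h /le_trans /(_ (maj_radius T0 M1 k)).
by rewrite exprSr mulrA ler_pM2r.
Qed.

Lemma dbound_geometric k : dbound k k * rho ^+ k <= 1.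
Proof.
have r0 := ltW rho0; rewrite -(ler_pM2r rho0) -mulrA -exprSr mul1r mulr_suml.
apply: (@le_trans _ _ (rho / (1 + T))); last first.
  by rewrite ler_piMr // invf_le1 ?lerDl ?(ltW T0) // addr_gt0.
have m0 : 0 <= (maj k).[rho].
  by have := nnegp_partial 0 (maj_nneg T0 M1 k) r0; rewrite big_geq.
apply: le_trans (maj_sum_le T0 M1 k.+1 m0 (maj_radius T0 M1 k)).
apply: ler_sum => j _; rewrite -mulrA ler_wpM2l ?exprn_ge0 // -horner_exp.
apply: nnegp_coef_le => //; exact/nnegpXn/maj_nneg.
Qed.

Lemma dcoef_le_diag k x : (forall i, (0 < i)%N -> nc (a i x) <= M ^+ i) -> I_ T x ->
  nc (dcoef k x) <= dbound k k.
Proof.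
move=> ax Ix; apply: dcoef_le => // i ik; apply: coef_le_maj => //.
exact: ltnW.
Qed.

Lemma coef_lipschitz k x y : I_ T x -> I_ T y ->
  nc (c k x - c k y) <= dbound k k * `|x - y|.
Proof.
move=> Ix Iy; have [->|k0] := posnP k.
  by rewrite !c0 // subrr normc0E mulr_ge0 // dbound_ge0.
apply: clipschitz_improve => //; first exact: dbound_ge0.
apply: ae_imp2 aM dc => z az dz z0T; exists (dcoef k z); last exact: dz.
exact: dcoef_le_diag (az (Iin z0T)) (Iin z0T).
Qed.

Variable r : C.
Hypothesis rr : nc r <= rho / 2.
Let s := nc r.
Let s0 : 0 <= s. Proof. exact: normc_ge0. Qed.

Lemma mul_exp_half (b B : R) k : 0 <= b -> b * rho ^+ k <= B ->
  b * s ^+ k.+1 <= B * s * 2^-1 ^+ k.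
Proof.
move=> b0 h; rewrite exprSr mulrA [leRHS]mulrAC ler_wpM2r //.
apply: (@le_trans _ _ (b * (rho / 2) ^+ k)).
  by rewrite ler_wpM2l // lerXn2r // nnegrE divr_ge0 // ltW.
by rewrite exprMn mulrA ler_wpM2r // exprn_ge0.
Qed.

Definition vsum (n : nat) (x : R) : C := \sum_(k < n.+1) c k x * r ^+ k.+1.

Lemma vsumS n x : vsum n.+1 x = vsum n x + c n.+1 x * r ^+ n.+2.
Proof. by rewrite /vsum big_ord_recr. Qed.

Lemma vsum_step n x : I_ T x -> nc (vsum n.+1 x - vsum n x) <= s * 2^-1 ^+ n.
Proof.
move=> Ix; rewrite vsumS addrC addKr Normc.normcM normcX.
apply: (le_trans (mul_exp_half (normc_ge0 _) (coef_geometric n.+1 Ix))).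
by rewrite exprS mulrA (mulrC 2) mulfK.
Qed.

Lemma vsum_le n x : I_ T x -> nc (vsum n x) <= 2 * rho.
Proof.
move=> Ix; have r0 := ltW rho0; rewrite (le_trans (normc_sum _ _ _)) //.
apply: le_trans (maj_radius T0 M1 n).
apply: le_trans (nnegp_partial n.+2 (maj_nneg T0 M1 n) r0).
rewrite big_nat_recl // -[leLHS]add0r lerD //.
  by rewrite mulr_ge0 // ?expr0 //; have := maj_nneg T0 M1 n; apply.
rewrite big_mkord; apply: ler_sum => k _; rewrite Normc.normcM normcX.
rewrite ler_pM ?normc_ge0 ?exprn_ge0 //; first by apply: coef_le_maj; rewrite // -ltnS.
rewrite lerXn2r ?nnegrE // (le_trans rr) // ler_pdivrMr // ler_peMr // ler1n //.
Qed.

(** Proportionality to the distance of x and y is the point: the limit inherits a Lipschitz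
    constant, and can be differentiated term by term. *)
Lemma vsum_diff_step n x y : I_ T x -> I_ T y ->
  nc ((vsum n.+1 x - vsum n.+1 y) - (vsum n x - vsum n y)) <= s * `|x - y| * 2^-1 ^+ n.
Proof.
move=> Ix Iy; rewrite !vsumS.
have -> : vsum n x + c n.+1 x * r ^+ n.+2 - (vsum n y + c n.+1 y * r ^+ n.+2) -
    (vsum n x - vsum n y) = (c n.+1 x - c n.+1 y) * r ^+ n.+2 by ring.
rewrite Normc.normcM normcX.
apply: (@le_trans _ _ (dbound n.+1 n.+1 * `|x - y| * s ^+ n.+2)).
  by rewrite ler_wpM2r ?exprn_ge0 // coef_lipschitz.
rewrite [leLHS]mulrAC [leRHS]mulrAC ler_wpM2r //.
apply: (le_trans (mul_exp_half (dbound_ge0 _ _) (dbound_geometric n.+1))).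
rewrite mul1r ler_wpM2l // exprS ler_piMl ?exprn_ge0 // invf_le1 // ler1n //.
Qed.

Definition dsum (n : nat) (x : R) : C := \sum_(1 <= i < n.+1) dcoef i x * r ^+ i.+1.

Lemma dsum_step n x : (forall i, (0 < i)%N -> nc (a i x) <= M ^+ i) -> I_ T x ->
  nc (dsum n.+1 x - dsum n x) <= s * 2^-1 ^+ n.
Proof.
move=> ax Ix; rewrite /dsum [X in X - _]big_nat_recr //= [X in nc X]addrAC subrr add0r.
rewrite Normc.normcM normcX.
apply: (@le_trans _ _ (dbound n.+1 n.+1 * s ^+ n.+2)).
  by rewrite ler_wpM2r ?exprn_ge0 // dcoef_le_diag.
apply: (le_trans (mul_exp_half (dbound_ge0 _ _) (dbound_geometric n.+1))).
rewrite mul1r ler_wpM2l // exprS ler_piMl ?exprn_ge0 // invf_le1 // ler1n //.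
Qed.

Lemma vsum_derive n x : 0 < x < T ->
  (forall i, (0 < i)%N -> cderiv (c i) x (dcoef i x)) -> cderiv (vsum n) x (dsum n x).
Proof.
move=> x0T dx; have d0 : cderiv (c 0) x 0.
  (* [c 0] is known to be 1 only on the interval, so y must stay inside. *)
  apply/cderivP => e e0; exists (Num.min x (T - x)).
    by case/andP: x0T => x0 xT; rewrite lt_min x0 subr_gt0.
  move=> y; rewrite lt_min !ltr_distl subrr => /andP[/andP[y0 _] /andP[_]].
  rewrite subrKC => yT; have Iy : I_ T y by apply: Iin; rewrite y0.
  by rewrite (c0 Iy) (c0 (Iin x0T)) mul0r !subrr normc0E mulr_ge0 // ltW.
have -> : vsum n = fun y => r * c 0 y + \sum_(i <- iota 1 n) r ^+ i.+1 * c i y.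
  apply/funext => y; rewrite /vsum -(big_mkord xpredT (fun k => c k y * r ^+ k.+1)).
  rewrite big_ltn // expr1 mulrC; congr (_ + _); rewrite /index_iota subSS subn0.
  by apply: eq_bigr => i _; rewrite mulrC.
have -> : dsum n x = r * 0 + \sum_(i <- iota 1 n) r ^+ i.+1 * dcoef i x.
  rewrite mulr0 add0r /dsum /index_iota subSS subn0.
  by apply: eq_bigr => i _; rewrite mulrC.
apply: cderivD; first exact: cderivZ.
apply: cderiv_sum => i; rewrite mem_iota => /andP[i0 _]; apply: cderivZ; exact: dx.
Qed.

(* The terms of degree at least n.+2 that are dropped from V ^+ j.+1 are small by
   comparison with the majorant at radius rho. *)
Lemma dsum_field n x : (forall i, (0 < i)%N -> nc (a i x) <= M ^+ i) -> I_ T x ->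
  nc (\sum_(1 <= j < n.+1) a j x * vsum n x ^+ j.+1 - dsum n x) <= rho * 2^-1 ^+ n.
Proof.
move=> ax Ix; have r0 := ltW rho0.
have V0 m : (Vpoly m x)`_0 = 0 by rewrite coef_Vpoly.
(* The truncations may be made common to all i <= n: higher coefficients do not reach degree i + 1,
   and neither do the powers with j > i. *)
have dE i : (i < n.+1)%N -> dcoef i x =
    \sum_(1 <= j < n.+1) a j x * (Vpoly n x ^+ j.+1)`_i.+1.
  move=> ni; rewrite [RHS](big_cat_nat _ (n := i.+1)) //=.
  rewrite [X in _ = _ + X]big_nat_cond [X in _ = _ + X]big1 ?addr0.
    apply: eq_bigr => j _; congr (_ * _); apply: (coef_exp_eq (d := i.+2)) => // e ei.
    by rewrite !coef_Vpoly -[(e <= i.+1)%N]ltnS ei (leq_trans (_ : e <= i.+1)%N).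
  move=> j /andP[/andP[ij _] _]; rewrite coef_exp_lt ?mulr0 //.
have -> : dsum n x = \sum_(1 <= j < n.+1) a j x *
    \sum_(0 <= d < n.+2) (Vpoly n x ^+ j.+1)`_d * r ^+ d.
  rewrite /dsum; under eq_big_nat => i /andP[_ ni] do rewrite dE // mulr_suml.
  rewrite exchange_big_nat /=; apply: eq_big_nat => -[//|j] _.
  rewrite [in RHS]big_ltn // [in RHS]big_ltn // !(coef_exp_lt (V0 n)) // !mul0r !add0r.
  by rewrite [in RHS]big_add1 /= mulr_sumr; apply: eq_bigr => i _; rewrite mulrA.
rewrite -sumrB (le_trans (normc_sum _ _ _)) //.
apply: (@le_trans _ _ (\sum_(1 <= j < n.+1) M ^+ j * (2^-1 ^+ n.+2 * (maj n).[rho] ^+ j.+1))).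
  apply: ler_sum_nat => j /andP[j0 _].
  rewrite -mulrBr Normc.normcM ler_pM ?normc_ge0 ?ax //.
  rewrite /vsum -horner_Vpoly -horner_exp -horner_exp; apply: horner_tail => //.
    move=> d; have dom : dominated d.+1 (Vpoly n x) (maj n).
      move=> e _; rewrite coef_Vpoly; case: ifP => [/andP[e0 en]|_]; last first.
        by rewrite normc0E; have := maj_nneg T0 M1 n; apply.
      by case: e e0 en => // e _ en; apply: coef_le_maj.
    by have := dominatedX j.+1 dom; apply.
under eq_bigr do rewrite mulrCA.
rewrite -mulr_sumr mulrC.
have m0 : 0 <= (maj n).[rho].
  by have := nnegp_partial 0 (maj_nneg T0 M1 n) r0; rewrite big_geq.
have h := maj_sum_le T0 M1 n m0 (maj_radius T0 M1 n).
have h1 : 2^-1 <= 1 :> R by rewrite invf_le1 // ler1n.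
have T1 : 1 <= 1 + T by rewrite lerDl ltW.
apply: ler_pM; [|exact: exprn_ge0| |].
- by apply: sumr_ge0 => j _; rewrite mulr_ge0 // exprn_ge0.
- by rewrite (le_trans h) // ler_piMr // invf_le1 // (lt_le_trans ltr01).
- by rewrite ler_wiXn2l // -addn2 leq_addr.
Qed.

Lemma series_solution : exists v, [/\ abel_solution T a r v,
  forall x, I_ T x -> nc (v x) <= 2 * rho &
  geo_cvg (4 * s) (fun n => vsum n T) (v T)].
Proof.
have r0 := ltW rho0.
have /boolp.choice[v hv] : forall x, exists l, I_ T x -> geo_cvg (4 * s) (vsum^~ x) l.
  move=> x; have [Ix|nIx] := pselect (I_ T x); last by exists 0.
  by have [l hl] := geo_limit (fun n => vsum_step n Ix); exists l.
have vB x : I_ T x -> nc (v x) <= 2 * rho.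
  by move=> Ix; apply: geo_cvg_norm (hv x Ix) _ => n; exact: vsum_le.
have I0 : I_ T 0 by rewrite II lexx ltW.
have IT : I_ T T by rewrite II lexx ltW.
exists v; split=> //; last exact: hv.
have hdiff x y : I_ T x -> I_ T y ->
    geo_cvg (2 * (s * `|x - y|)) (fun n => vsum n x - vsum n y) (v x - v y).
  move=> Ix Iy.
  apply: (@geo_tail _ _ _ (4 * s + 4 * s) _ (fun n => vsum_diff_step n Ix Iy)) => n.
  have -> : v x - v y - (vsum n x - vsum n y) = (v x - vsum n x) - (v y - vsum n y) by ring.
  by rewrite (le_trans (normcB_le _ _)) // mulrDl lerD // hv.
split.
- apply: (geo_cvg_unique (hv 0 I0) (K' := 0)) => n; rewrite mul0r /vsum.
  rewrite big_ord_recl /= c0 // mul1r expr1 big1 ?addr0 ?subrr ?normc0E // => k _.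
  by rewrite ci ?mul0r.
(* The partial sum of index 0 is the constant r, so this instance of the rate is a Lipschitz
   bound. *)
- exists (2 * s) => x y Ix Iy; have := hdiff _ _ Ix Iy 0%N.
  rewrite expr0 mulr1 /vsum !big_ord_recl !big_ord0 /= !addr0 !c0 // subrr subr0.
  by rewrite mulrA.
- apply: ae_interior; apply: ae_imp2 aM dc => x ax dx x0T.
  have Ix := Iin x0T; have {}ax := ax Ix; have {}dx := dx x0T.
  have [l hl] := geo_limit (fun n => dsum_step n ax Ix).
  exists l.
    (* The three errors come from the limit of [dsum], from [dsum_field] and from replacing [vsum]
       by v. The sum of index n + 1 is estimated at rate 2^-n, whence the factor 2; the empty sum
       accounts for [nc l]. *)
    pose K := 2 * (4 * s + rho + 4 * s) + nc l.
    apply: (@geo_ccvg _ _ K) => -[|n].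
      rewrite big_geq // subr0 expr0 mulr1 /K lerDr mulr_ge0 // !addr_ge0 // mulr_ge0 //.
    rewrite (le_trans (normc_dist _ _ (dsum n x))) //.
    have h1 := hl n; have h2 := dsum_field n ax Ix; have h3 := hv x Ix n.
    have h4 : nc (\sum_(1 <= j < n.+1) a j x * vsum n x ^+ j.+1 -
        \sum_(1 <= j < n.+1) a j x * v x ^+ j.+1) <= nc (vsum n x - v x).
      apply: (abel_field_lipschitz T0 M1 _ ax).
        by rewrite (le_trans (vsum_le n Ix)) // ler_wpM2r // ler_nat.
      by rewrite (le_trans (vB x Ix)) // ler_wpM2r // ler_nat.
    have h5 := normc_dist (dsum n x) (\sum_(1 <= j < n.+1) a j x * v x ^+ j.+1)
      (\sum_(1 <= j < n.+1) a j x * vsum n x ^+ j.+1).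
    have l0 : 0 <= nc l * 2^-1 ^+ n.+1 by rewrite mulr_ge0 ?normc_ge0 ?exprn_ge0.
    rewrite normcB_sym in h2; rewrite [nc (v x - _)]normcB_sym in h3.
    rewrite /K mulrDl exprS in l0 *.
    move: h1 h2 h3 h4 h5 l0; move: (2^-1 ^+ n) => e; lra.
  apply/cderivP => e e0.
  (* The index is fixed before the neighbourhood: the errors of increment and slope are both at most
     a multiple of 2^-n times the distance, uniformly in y. *)
  have [n Kn] : exists n, (2 * s + 4 * s) * 2^-1 ^+ n <= e / 2.
    by apply: half_exp_small; rewrite divr_gt0.
  have /cderivP/(_ (e / 2))[|d d0 hd] := vsum_derive n x0T dx; first by rewrite divr_gt0.
  case/andP: (x0T) => x0 xT.
  exists (Num.min d (Num.min x (T - x))); first by rewrite !lt_min d0 x0 subr_gt0.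
  move=> y; rewrite !lt_min => /andP[yd]; rewrite !ltr_distl subrr => /andP[/andP[y0 _] /andP[_]].
  rewrite subrKC => yT; have Iy : I_ T y by apply: Iin; rewrite y0.
  have -> : v y - v x - l * (y - x)%:C%C =
    (v y - v x - (vsum n y - vsum n x)) +
    (vsum n y - vsum n x - dsum n x * (y - x)%:C%C) -
    (l - dsum n x) * (y - x)%:C%C by ring.
  rewrite (le_trans (normcB_le _ _)) // (le_trans (lerD (normcD_le _ _) (lexx _))) //.
  rewrite Normc.normcM normcR.
  have h1 := hdiff _ _ Iy Ix n; have h2 := hd y yd.
  have h3 : nc (l - dsum n x) * `|y - x| <= 4 * s * 2^-1 ^+ n * `|y - x|.
    by rewrite ler_wpM2r //; exact: hl.
  have h4 := ler_wpM2r (normr_ge0 (y - x)) Kn.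
  apply: (le_trans (lerD (lerD h1 h2) h3)).
  move: h4; move: (2^-1 ^+ n) `|y - x| => z t; nra.
Qed.

End SeriesSolution.

Theorem theorem5p4 (R : realType) (T : R) (hT : 0 < T)
    (a : nat -> R -> R[i]) (ha : in_X T a) :
  [/\ is_character (FdB_flow T a T),
      is_character (rho (chen T a)),
      has_expansion (first_return_map T a) (Theta (FdB_flow T a T)) &
      Theta (FdB_flow T a T) = Theta (rho (chen T a))].
Proof.
have flowE := FdB_flow_chen hT ha.
have sol := FdB_flow_solution hT ha.
have IT : `[0, T]%classic T by rewrite /= in_itv /= lexx ltW.
have charT := FdB_solution_character hT sol IT.
split=> //.
- by case: charT => h1 hM; split=> [|p q]; rewrite -!flowE.
- have [M M1 aM] := in_X_bound ha.
  pose c k x := FdB_flow T a x (t_ R[i] k).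
  have c0 x : `[0, T]%classic x -> c 0%N x = 1.
    by move=> Ix; exact: (FdB_solution_one sol Ix).
  have [z l _] := sol.
  have cl k : clipschitz `[0, T]%classic (c k) by exact: l.
  have ci k : (0 < k)%N -> c k 0 = 0.
    case: k => // k _; apply: (etrans (z _)); apply: (etrans (counitlU _ _)).
    by case: eqP => // /(congr1 (@wdeg)); rewrite wdeg1 wdegU.
  have dc := FdB_solution_t hT sol.
  exists (radius T M / 2); first by rewrite divr_gt0 // radius_gt0.
  move=> r /ltW rr.
  have [v [vsol vB vT]] := series_solution hT M1 aM c0 cl ci dc rr.
  have -> : first_return_map T a r = v T.
    (* The series supplies existence, so the default value of [xget] is ruled out; the chosen u is
       then identified with v. *)
    have [u usol ->] : exists2 u, abel_solution T a r u & first_return_map T a r = u T.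
      apply: (@xgetPex _ _ [set w | exists2 v, abel_solution T a r v & w = v T]).
      by exists (v T), v.
    exact: (abel_unique hT M1 aM usol vsol vB).
  (* The partial sum with n + 2 terms is [vsum n], so its rate 4 |r| 2^-n reads 16 |r| 2^-(n+2). The
     first two partial sums are 0, with error |v T| at most 2 |v T| 2^-1. *)
  apply: (@geo_ccvg _ _ (16 * Normc.normc r + 2 * Normc.normc (v T))) => n.
  have r0 := normc_ge0 r; have v0 := normc_ge0 (v T).
  case: n => [|[|n]].
  + by rewrite big_ord0 subr0 expr0; lra.
  + by rewrite big_ord_recl big_ord0 /= mul0r addr0 subr0 expr1; lra.
  rewrite big_ord_recl /= mul0r add0r.
  have -> : \sum_(k < n.+1) Theta (FdB_flow T a T) (bump 0 k) * r ^+ bump 0 k = vsum c r n T.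
    apply: eq_bigr => k _; congr (_ * _); rewrite /bump /=.
    by case: (k : nat) => [|j] //=; rewrite c0.
  rewrite (le_trans (vT n)) // exprS exprS.
  have : 0 <= 2^-1 ^+ n :> R by rewrite exprn_ge0.
  move: (2^-1 ^+ n) => e e0.
  have : 0 <= Normc.normc (v T) * e by rewrite mulr_ge0.
  lra.
apply/funext => -[|[|n]] //=; exact: flowE.
Qed.
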